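(* Let $\eta,\kappa,\nu,\chi,\phi,\psi$ satisfy the Fourier-transformed linearized Einstein-scalar system (E1)–(E4) of the context, in the zero shift gauge $\chi^i\equiv0$ ($1\le i\le d$) on $Z_P$. Let $m_P\in\mathbb N_0$ be sufficiently large and $\rho_0$ sufficiently small, and let $U_{Pz}^{(m_P)}:=\mathcal E_PQ_P^{(m_P)}U_P$ on $Z_P$. Then: (1) for every $\xi\in\mathbb R^d$ the limit $U_{Pz}^{(m_P)}(0,\xi):=\lim_{\tau\searrow0}U_{Pz}^{(m_P)}(\tau,\xi)$ exists and is finite; (2) for every $\xi\in\mathbb R^d$ and $0\le t_0,t_1\le T$ with $\langle\langle\xi\rangle\rangle t_0\le\rho_0$ and $\langle\langle\xi\rangle\rangle t_1\le\rho_0$, $$|U_{Pz}^{(m_P)}(t_1,\xi)|\lesssim|U_{Pz}^{(m_P)}(t_0,\xi)|,$$ where the value at time $0$ is the limit in (1).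
   Context: Conventions. $\mathbb N=\{1,2,\dots\}$, $\mathbb N_0=\mathbb N\cup\{0\}$, $\imath=\sqrt{-1}$, $\langle\eta\rangle=(1+|\eta|^2)^{1/2}$; $\lesssim$ means up to a multiplicative constant independent of $t_0,t_1,\xi$ and of the solution. System. Fix $d\in\mathbb N$, $T>0$, $\ell_1,\dots,\ell_d>-1$, $\ell_\phi\in\mathbb R$. Unknowns: complex-valued functions $\eta_i{}^j,\kappa_i{}^j,\nu,\chi^i,\phi,\psi$ on $(0,T]_t\times\mathbb R^d_\xi$ ($1\le i,j\le d$), with $\eta,\kappa,\phi,\psi$ being $C^1$ in $t$ (spatial Fourier transforms of linearized metric, second fundamental form, lapse, shift, scalar field and its time derivative about a Kasner spacetime with exponents $-\ell_i$). With $\delta_i{}^j$ the Kronecker delta: (E1) Evolution, for $1\le i,j\le d$: $t\partial_t\eta_i{}^j=\kappa_i{}^j+2(\ell_j-\ell_i)\eta_i{}^j+\ell_i\delta_i{}^j\nu-\frac12\imath(\xi_i\chi^j+t^{2\ell_j-2\ell_i}\xi_j\chi^i)$; $t\partial_t\kappa_i{}^j=\sum_a(-t^{2+2\ell_a}\xi_a^2\eta_i{}^j-t^{2+2\ell_j}\xi_i\xi_j\eta_a{}^a+t^{2+2\ell_a}\xi_i\xi_a\eta_a{}^j+t^{2+2\ell_j}\xi_j\xi_a\eta_i{}^a)+t^{2+2\ell_j}\xi_i\xi_j\nu-\ell_i\delta_i{}^j\nu+\imath(\ell_j-\ell_i)\xi_i\chi^j$; $t\partial_t\phi=\psi+\ell_\phi\nu$;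 $\quad t\partial_t\psi=-\sum_at^{2+2\ell_a}\xi_a^2\phi-\ell_\phi\nu$. (E2) Elliptic: $(1+\sum_at^{2+2\ell_a}\xi_a^2)\nu=2\sum_{a,b}(t^{2+2\ell_a}\xi_a^2\eta_b{}^b-t^{2+2\ell_a}\xi_a\xi_b\eta_a{}^b)$. (E3) Constraints, for $1\le j\le d$: $\sum_{a,b}(t^{2+2\ell_a}\xi_a^2\eta_b{}^b-t^{2+2\ell_a}\xi_a\xi_b\eta_a{}^b)+\sum_a\ell_a\kappa_a{}^a+2\ell_\phi\psi=0$; $\imath\sum_a[\xi_a\kappa_j{}^a+(\ell_a-\ell_j)\xi_j\eta_a{}^a]+2\imath\ell_\phi\xi_j\phi=0$; $\imath\sum_a(t^{2\ell_a}\xi_a\kappa_a{}^j+\ell_at^{2\ell_j}\xi_j\eta_a{}^a-2\ell_at^{2\ell_a}\xi_a\eta_a{}^j)+2\imath\ell_\phi t^{2\ell_j}\xi_j\phi=0$. (E4) Symmetry, for $1\le i,j\le d$: $t^{2\ell_i}\eta_i{}^j=t^{2\ell_j}\eta_j{}^i$, $\ t^{2\ell_i}(\kappa_i{}^j-2\ell_i\eta_i{}^j)=t^{2\ell_j}(\kappa_j{}^i-2\ell_j\eta_j{}^i)$. Zone and classes. $\mathfrak H=[\sum_it^{2\ell_i}\xi_i^2]^{1/2}$, $\ell_*=\min_i\ell_i$, $\langle\langle\xi\rangle\rangle=\max_i\langle\xi_i\rangle^{1/(\ell_i+1)}$, $z=\langle\langle\xi\rangle\rangle t$, $\partial_z=\langle\langle\xi\rangle\rangle^{-1}\partial_t$,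 $Z_P=\{(t,\xi)\in(0,T]\times\mathbb R^d:z\le\rho_0\}$ with $\rho_0\in(0,1)$ small. Let $n=2d^2+2$. $\mathcal S_*^q(Z_P)$ is the set of continuous $n\times n$ complex matrix-valued $f$ on $Z_P$, smooth in $t$ for each $\xi$, such that for some $p\in\mathbb N_0$ and all $k\in\mathbb N_0$, $|(z\partial_z)^kf|\le C_kz^q(1+|\log z|)^p$. Renormalized unknowns. $\bar\eta_i{}^j=t^{\ell_i-\ell_j}\eta_i{}^j$, $\bar\kappa_i{}^j=t^{\ell_i-\ell_j}\kappa_i{}^j$; $\bar\Upsilon_i{}^j=\bar\eta_i{}^j$ if $\ell_i=\ell_j$ and $\bar\Upsilon_i{}^j=\bar\eta_i{}^j+\frac1{2(\ell_j-\ell_i)}\bar\kappa_i{}^j$ if $\ell_i\ne\ell_j$; $U_P^T=[\bar\Upsilon_1{}^1,\bar\kappa_1{}^1,\bar\Upsilon_1{}^2,\bar\kappa_1{}^2,\dots,\bar\Upsilon_d{}^d,\bar\kappa_d{}^d,\phi,\psi]$. Eliminating $\nu$ from (E1) through (E2) and setting $\chi\equiv0$, (E1) becomes a closed linear system (treating all components as independent unknowns) $\partial_zU_P=(z^{-1}B_P+R_P)U_P$, with the constant Jordan-form matrix $B_P=\operatorname{diag}(B_{(11)},B_{(12)},\dots,B_{(dd)},B_{(0)})$, $B_{(0)}=\begin{bmatrix}0&1\\0&0\end{bmatrix}$, $B_{(ij)}=\begin{bmatrix}\ell_j-\ell_i&\epsilon_{ij}\\0&\ell_i-\ell_j\end{bmatrix}$,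 $\epsilon_{ij}=1$ if $\ell_i=\ell_j$ and $0$ otherwise; this defines $R_P$, and $R_P\in\mathcal S_*^{a_P}(Z_P)$ with $a_P=-1+2(\ell_*+1)$. Fix sequences, $m\in\mathbb N$: $D_P^{(m)}\in\mathcal S_*^{m(a_P+1)-1}(Z_P)$ diagonal, $N_P^{(m)}\in\mathcal S_*^{m(a_P+1)}(Z_P)$, $R_P^{(m)}\in\mathcal S_*^{m(a_P+1)+a_P}(Z_P)$ such that, with $Q_P^{(m)}=I_n+\sum_{k=1}^mN_P^{(k)}$, $$R_P^{(m)}=\sum_{k=1}^m\partial_zN_P^{(k)}+Q_P^{(m)}(z^{-1}B_P+R_P)-\Big(z^{-1}B_P+\sum_{k=1}^mD_P^{(k)}\Big)Q_P^{(m)};\qquad Q_P^{(0)}=I_n.$$ (Objects for smaller $\rho_0$ are restrictions of those for larger $\rho_0$.) Put $\mathcal E_P=\exp(-(\log z)B_P)$. *)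

(* Defs.v *)
From mathcomp Require Import all_boot all_order all_algebra.
From mathcomp Require Import all_classical all_reals all_analysis.
From mathcomp Require Import complex.

Set Implicit Arguments.
Unset Strict Implicit.
Unset Printing Implicit Defensive.

Import Order.TTheory GRing.Theory Num.Theory.
Import numFieldNormedType.Exports.

Local Open Scope classical_set_scope.
Local Open Scope ring_scope.

(* R[i] packed as a numClosedFieldType: the topology and the normed module
   structure of a number field are found on the sort of this structure, not on
   R[i] itself. Norms take their values in CC R. *)
Definition CC (R : realType) : numClosedFieldType := R[i].

Definition rC (R : realType) (x : R) : CC R := (x%:C)%C.

(* A point is a pair (t, xi). *)
Notation tpoint R d := (R * 'rV[R]_d)%type.

(* The size n = 2 d ^ 2 + 2 of the first order system. *)
Notation dimP d := (2 * d ^ 2).+2%N.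

Section TimeDerivative.
Variables (R : realType) (d : nat) (V : normedModType (CC R)).
Implicit Types (Z : set (tpoint R d)) (f : tpoint R d -> V) (x : tpoint R d).

Definition dquot f x (s : R) : V := rC (s - x.1)^-1 *: (f (s, x.2) - f x).

(* Difference quotients are taken inside Z, so that the derivative is one-sided
   at the end point of a time slice of Z. *)
Definition pdt Z f x : V :=
  lim (dquot f x @ within [set s | Z (s, x.2)] (x.1)^').

Definition pderivable Z f x : Prop :=
  cvg (dquot f x @ within [set s | Z (s, x.2)] (x.1)^').

Definition C1_in_time Z f : Prop :=
  (forall x, Z x -> pderivable Z f x) /\
  (forall xi, {within [set t | Z (t, xi)],
                 continuous (fun t : R => pdt Z f (t, xi))}).

Definition smooth_in_time Z f : Prop :=
  forall k x, Z x -> pderivable Z (iter k (pdt Z) f) x.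

End TimeDerivative.

Definition expmx (R : realType) (n : nat) (A : 'M[CC R]_n.+1) : 'M[CC R]_n.+1 :=
  lim (series (fun k : nat => (k`!%:R)^-1 *: A ^+ k) @ \oo).

Section System.
Variables (R : realType) (d : nat).

Record fields := Fields {
  eta : 'I_d -> 'I_d -> CC R;  (* eta i j is eta_i^j *)
  kap : 'I_d -> 'I_d -> CC R;
  nu  : CC R;
  chi : 'I_d -> CC R;
  phi : CC R;
  psi : CC R }.

Variables (ell : 'I_d -> R) (lphi : R).
Implicit Types (x : tpoint R d) (F : fields) (i j a b : 'I_d).

Definition tp x (e : R) : CC R := rC (x.1 `^ e).
Definition xc x i : CC R := rC (x.2 0 i).
Definition lc i : CC R := rC (ell i).

Definition symb x : CC R := \sum_a tp x (2 + 2 * ell a) * xc x a ^+ 2.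

Definition curv x F : CC R :=
  \sum_a \sum_b (tp x (2 + 2 * ell a) * xc x a ^+ 2 * eta F b b
                 - tp x (2 + 2 * ell a) * xc x a * xc x b * eta F a b).

(* The right-hand sides of the equations for t d/dt of the unknowns. *)
Definition rhs_eta x F i j : CC R :=
  kap F i j + 2 * (lc j - lc i) * eta F i j + lc i * (i == j)%:R * nu F
  - 2^-1 * 'i * (xc x i * chi F j
                 + tp x (2 * ell j - 2 * ell i) * xc x j * chi F i).

Definition rhs_kap x F i j : CC R :=
  \sum_a (- (tp x (2 + 2 * ell a) * xc x a ^+ 2 * eta F i j)
          - tp x (2 + 2 * ell j) * xc x i * xc x j * eta F a a
          + tp x (2 + 2 * ell a) * xc x i * xc x a * eta F a j
          + tp x (2 + 2 * ell j) * xc x j * xc x a * eta F i a)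
  + tp x (2 + 2 * ell j) * xc x i * xc x j * nu F
  - lc i * (i == j)%:R * nu F
  + 'i * (lc j - lc i) * xc x i * chi F j.

Definition rhs_phi F : CC R := psi F + rC lphi * nu F.

Definition rhs_psi x F : CC R :=
  - (\sum_a tp x (2 + 2 * ell a) * xc x a ^+ 2 * phi F) - rC lphi * nu F.

Definition slab (T : R) : set (tpoint R d) := [set x | 0 < x.1 <= T].

Definition evolution (T : R) (u : tpoint R d -> fields) : Prop :=
  let tdt (f : tpoint R d -> CC R) x := rC x.1 * pdt (slab T) f x in
  forall x, slab T x ->
  [/\ forall i j, tdt (fun y => eta (u y) i j) x = rhs_eta x (u x) i j,
      forall i j, tdt (fun y => kap (u y) i j) x = rhs_kap x (u x) i j,
      tdt (fun y => phi (u y)) x = rhs_phi (u x) &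
      tdt (fun y => psi (u y)) x = rhs_psi x (u x)].

Definition elliptic x F : Prop := (1 + symb x) * nu F = 2 * curv x F.

Definition constraints x F : Prop :=
  [/\ curv x F + \sum_a lc a * kap F a a + 2 * rC lphi * psi F = 0,
      forall j,
        'i * \sum_a (xc x a * kap F j a + (lc a - lc j) * xc x j * eta F a a)
        + 2 * 'i * rC lphi * xc x j * phi F = 0 &
      forall j,
        'i * \sum_a (tp x (2 * ell a) * xc x a * kap F a j
                     + lc a * tp x (2 * ell j) * xc x j * eta F a a
                     - 2 * lc a * tp x (2 * ell a) * xc x a * eta F a j)
        + 2 * 'i * rC lphi * tp x (2 * ell j) * xc x j * phi F = 0].

Definition symmetry x F : Prop :=
  forall i j,
    tp x (2 * ell i) * eta F i j = tp x (2 * ell j) * eta F j i /\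
    tp x (2 * ell i) * (kap F i j - 2 * lc i * eta F i j)
    = tp x (2 * ell j) * (kap F j i - 2 * lc j * eta F j i).

Definition solution (T : R) (u : tpoint R d -> fields) : Prop :=
  [/\ forall i j, C1_in_time (slab T) (fun y => eta (u y) i j),
      forall i j, C1_in_time (slab T) (fun y => kap (u y) i j),
      C1_in_time (slab T) (fun y => phi (u y)) &
      C1_in_time (slab T) (fun y => psi (u y))] /\
  [/\ evolution T u,
      forall x, slab T x -> elliptic x (u x),
      forall x, slab T x -> constraints x (u x) &
      forall x, slab T x -> symmetry x (u x)].

(* The infimum over the finite, nonempty index set is the minimum. *)
Definition ellmin : R := inf (range ell).

Definition aP : R := -1 + 2 * (ellmin + 1).

Definition jap (y : R) : R := Num.sqrt (1 + y ^+ 2).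

(* Each term is at least 1 when all ell i > -1, so that the default value 1 of
   the iterated maximum does not change it. *)
Definition djap (xi : 'rV[R]_d) : R :=
  \big[Num.max/1]_i (jap (xi 0 i) `^ (ell i + 1)^-1).

Definition zvar x : R := djap x.2 * x.1.

Definition zoneP (T rho : R) : set (tpoint R d) :=
  [set x | 0 < x.1 <= T /\ zvar x <= rho].

Definition pdz (V : normedModType (CC R)) (Z : set (tpoint R d))
    (f : tpoint R d -> V) x : V := rC (djap x.2)^-1 *: pdt Z f x.

Definition zpdz (V : normedModType (CC R)) (Z : set (tpoint R d))
    (f : tpoint R d -> V) x : V := rC (zvar x) *: pdz Z f x.

Definition Sstar (Z : set (tpoint R d)) (q : R)
    (f : tpoint R d -> 'M[CC R]_(dimP d)) : Prop :=
  [/\ {within Z, continuous f},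
      smooth_in_time Z f &
      exists p : nat, forall k : nat, exists Ck : R, forall x, Z x ->
        `|iter k (zpdz Z) f x|
        <= rC (Ck * zvar x `^ q * (1 + `|ln (zvar x)|) ^+ p)].

(* Rows are counted from 0 and come in blocks of two: rows 2q and 2q+1 belong
   to the pair (i, j) when q = i * d + j, and to the scalar field (None) when
   q = d ^ 2. *)
Definition block (r : 'I_(dimP d)) : option ('I_d * 'I_d) :=
  [pick ij : 'I_d * 'I_d | (ij.1 * d + ij.2 == r./2)%N].

Definition bar x (f : 'I_d -> 'I_d -> CC R) i j : CC R :=
  tp x (ell i - ell j) * f i j.

Definition Upsbar x F i j : CC R :=
  if ell i == ell j then bar x (eta F) i j
  else bar x (eta F) i j + (2 * (lc j - lc i))^-1 * bar x (kap F) i j.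

Definition UP x F : 'cV[CC R]_(dimP d) :=
  \col_r match block r with
         | Some (i, j) => if odd r then bar x (kap F) i j else Upsbar x F i j
         | None => if odd r then psi F else phi F
         end.

Definition BP : 'M[CC R]_(dimP d) :=
  \matrix_(r, c)
    if r./2 != c./2 then 0 else
    match block r, odd r, odd c with
    | Some (i, j), false, false => lc j - lc i
    | Some (i, j), false, true  => (ell i == ell j)%:R
    | Some (i, j), true,  true  => lc i - lc j
    | None,        false, true  => 1
    | _, _, _ => 0
    end.

(* The inverse of UP x on fields with zero shift and with the lapse eliminated
   through the elliptic equation. *)
Definition fields_of_UP x (U : 'cV[CC R]_(dimP d)) : fields :=
  let kb i j : CC R := U (inord (2 * (i * d + j)).+1) 0 in
  let ub i j : CC R := U (inord (2 * (i * d + j))) 0 in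
  let eb i j : CC R :=
    if ell i == ell j then ub i j
    else ub i j - (2 * (lc j - lc i))^-1 * kb i j in
  let et i j : CC R := tp x (ell j - ell i) * eb i j in
  let F0 := Fields et (fun i j => tp x (ell j - ell i) * kb i j) 0 (fun=> 0)
              (U (inord (2 * d ^ 2)) 0) (U (inord (2 * d ^ 2).+1) 0) in
  Fields (eta F0) (kap F0) ((1 + symb x)^-1 * (2 * curv x F0)) (chi F0)
    (phi F0) (psi F0).

(* t d/dt of UP x F along the evolution equations. UP x is linear, and its
   explicit time dependence, through the weights t ^ (ell i - ell j), adds the
   terms (ell i - ell j) * eta and (ell i - ell j) * kap. *)
Definition UP_rate x F : 'cV[CC R]_(dimP d) :=
  UP x (Fields (fun i j => (lc i - lc j) * eta F i j + rhs_eta x F i j)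
               (fun i j => (lc i - lc j) * kap F i j + rhs_kap x F i j)
               0 (fun=> 0) (rhs_phi F) (rhs_psi x F)).

(* The closed system reads z d/dz U = AP U (and z d/dz = t d/dt). *)
Definition AP x : 'M[CC R]_(dimP d) :=
  \matrix_(r, c) UP_rate x (fields_of_UP x (delta_mx c 0)) r 0.

Definition RP x : 'M[CC R]_(dimP d) := rC (zvar x)^-1 *: (AP x - BP).

Definition EP x : 'M[CC R]_(dimP d) := expmx (- rC (ln (zvar x)) *: BP).

Definition QP (N : nat -> tpoint R d -> 'M[CC R]_(dimP d)) (m : nat) x :
  'M[CC R]_(dimP d) := 1%:M + \sum_(1 <= k < m.+1) N k x.

Definition UPz (N : nat -> tpoint R d -> 'M[CC R]_(dimP d)) (m : nat)
    (u : tpoint R d -> fields) x : 'cV[CC R]_(dimP d) :=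
  EP x *m QP N m x *m UP x (u x).

Definition UPz0 (N : nat -> tpoint R d -> 'M[CC R]_(dimP d)) (m : nat)
    (u : tpoint R d -> fields) (xi : 'rV[R]_d) : 'cV[CC R]_(dimP d) :=
  lim ((fun tau : R => UPz N m u (tau, xi)) @ 0^'+).

Definition UPz_ext (N : nat -> tpoint R d -> 'M[CC R]_(dimP d)) (m : nat)
    (u : tpoint R d -> fields) x : 'cV[CC R]_(dimP d) :=
  if x.1 == 0 then UPz0 N m u x.2 else UPz N m u x.

End System.

(* Main.v *)
From HB Require Import structures.
Require Import Defs.
From mathcomp Require Import all_boot all_order all_algebra.
From mathcomp Require Import all_classical all_reals all_analysis.
From mathcomp Require Import complex.
From mathcomp Require Import ring lra.

Set Implicit Arguments.
Unset Strict Implicit.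
Unset Printing Implicit Defensive.

Import Order.TTheory GRing.Theory Num.Theory.
Import numFieldNormedType.Exports.

Local Open Scope classical_set_scope.
Local Open Scope ring_scope.

(** Fix the frequency xi and put z = djap xi * t, B = BP, U = UP, Q = QP and
    W = E Q U with E = exp(- log z B). The two bounds say that W is a solution
    of a linear ordinary differential equation whose coefficients are
    integrable in z up to z = 0, uniformly in xi.

    Along a solution with zero shift, U solves t d/dt U = AP U: the lapse is
    eliminated by the elliptic equation, whose coefficient 1 + symb is at least
    1 ([UP_rate_AP]). The identity which defines the remainder Rm makes V = Q U
    a solution of V' = B V / t + djap xi ((sum of the D k) V + Rm U)
    ([deriv_within_Vv]). Since E' = - E B / t, conjugating by E cancels the
    singular term and leaves
    W' = djap xi (E (sum of the D k) V + E Rm U) ([deriv_within_Wv]).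

    The matrix B is L + N with L diagonal and N N = L N = N L = 0; hence
    exp(y B) = exp(y L) + y N is explicit ([expmx_diag_nil]). Let
    al = aP + 1 > 0.
    - As the D k are diagonal, exp(y L) commutes with their sum S, and
      E S E^-1 - S = O((|log z| + |log z| ^ 2) |S|): conjugation costs only
      logarithms, whatever the size of the entries of L ([zO_conj]). Like S, the
      conjugate is of size z ^ (al - 1), up to an arbitrarily small loss in the
      exponent.
    - E and E^-1 are bounded by z ^ (- M), up to logarithms, with M a bound on
      the entries of L ([zO_EP], [zO_Einv]). In E Rm U they cost z ^ (- 2 M),
      which Rm absorbs as soon as m * al >= 2 M; this is the condition that m is
      large.
    - U is controlled by V, because Q - 1 is at most 1/2 in norm for z small
      ([near_identity_le]); this is the condition that rho0 is small.

    Therefore |W'| <= K djap xi z ^ (al / 2 - 1) |W|, and the right-hand side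
    has the primitive (K / (al / 2)) z ^ (al / 2), bounded because z < 1. The
    inequality of Gronwall, applied to the sum of the squared real and imaginary
    parts of W, compares |W| at any two positive times with a constant which
    depends on neither of them nor on xi ([gronwall_energy]). Consequently W' is
    integrable near 0, W has a limit there ([gronwall_cvg]), and the comparison
    extends to time 0 by continuity ([gronwall_energy_lim]). *)

(** * Real numbers inside the complex field *)

Section Embedding.
Variable R : realType.
Implicit Types (x y : R) (z w : CC R).

Fact rC_is_additive : additive (@rC R).
Proof. by move=> x y; rewrite /rC rmorphB. Qed.
Fact rC_is_multiplicative : multiplicative (@rC R).
Proof. by split => [x y|]; rewrite /rC ?rmorphM ?rmorph1. Qed.
HB.instance Definition _ := GRing.isAdditive.Build R (CC R) (@rC R) rC_is_additive.
HB.instance Definition _ :=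
  GRing.isMultiplicative.Build R (CC R) (@rC R) rC_is_multiplicative.

Definition reC z : R := complex.Re (z : R[i]).
Definition imC z : R := complex.Im (z : R[i]).

Lemma rC0 : rC 0 = 0 :> CC R.
Proof. exact: rmorph0. Qed.
Lemma ler_rC x y : (rC x <= rC y) = (x <= y).
Proof. exact: lecR. Qed.
Lemma ltr_rC x y : (rC x < rC y) = (x < y).
Proof. exact: ltcR. Qed.
Lemma norm_rC x : `|rC x| = rC `|x|.
Proof. by rewrite /rC [LHS](@normc_def R) /= expr0n addr0 sqrtr_sqr. Qed.
Lemma normC_rC z : `|z| = rC (Num.sqrt (reC z ^+ 2 + imC z ^+ 2)).
Proof. exact: (@normc_def R). Qed.
Lemma reC_le z c : `|z| <= rC c -> `|reC z| <= c.
Proof.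
rewrite normC_rC ler_rC; apply: le_trans; rewrite -sqrtr_sqr ler_wsqrtr //.
by rewrite lerDl sqr_ge0.
Qed.

Lemma imC_le z c : `|z| <= rC c -> `|imC z| <= c.
Proof.
rewrite normC_rC ler_rC; apply: le_trans; rewrite -sqrtr_sqr ler_wsqrtr //.
by rewrite lerDr sqr_ge0.
Qed.

Lemma gt0_rC (e : CC R) : 0 < e -> exists2 r : R, 0 < r & e = rC r.
Proof.
suff H (c : R[i]) : 0 < c -> exists2 r : R, 0 < r & c = (r%:C)%C by exact: H.
by case: c => a b; rewrite (@ltcE R) /= => /andP[/eqP -> a0]; exists a.
Qed.

Lemma reCB z w : reC (z - w) = reC z - reC w.
Proof. by rewrite /reC; destruct (z : R[i]), (w : R[i]). Qed.
Lemma imCB z w : imC (z - w) = imC z - imC w.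
Proof. by rewrite /imC; destruct (z : R[i]), (w : R[i]). Qed.
Lemma reCM x z : reC (rC x * z) = x * reC z.
Proof.
suff H (c : R[i]) : complex.Re (x%:C%C * c) = x * complex.Re c by exact: H.
by case: c => a b /=; rewrite mul0r subr0.
Qed.

Lemma imCM x z : imC (rC x * z) = x * imC z.
Proof.
suff H (c : R[i]) : complex.Im (x%:C%C * c) = x * complex.Im c by exact: H.
by case: c => a b /=; rewrite mul0r addr0.
Qed.
End Embedding.

(** * Derivatives inside a set of a complex valued curve *)

Section Deriv.
Variable R : realType.
Implicit Types (A : set R) (f g : R -> CC R) (s : R).

(** The quotients are taken inside [A], as for the derivative of the unknowns
    along a time slice, so that the derivative is one-sided at an end point of
    [A]. A wrapper rather than a plain definition, to keep conversion from
    unfolding the filters. *)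
Variant deriv_within A f s (l : CC R) : Prop :=
  HasD of (fun t => rC (t - s)^-1 * (f t - f s)) @ within A s^' --> l.

Lemma mx_norm_leP m n (M : 'M[CC R]_(m, n)) c : 0 <= c ->
  (`|M| <= c) <-> (forall i j, `|M i j| <= c).
Proof.
move=> /nonnegP[{}c].
rewrite [`|M|]mx_normE num_le; split=> [/bigmax_leP[_ H] i j|H].
  by have := H (i, j) isT; rewrite -num_le.
apply/bigmax_leP; split=> [|[i j] _]; first by rewrite -num_le /=.
by rewrite -num_le /= H.
Qed.

Lemma cvg_rC (S : Type) (F : set_system S) {FF : Filter F} (g : S -> R) (l : R) :
  g @ F --> l -> (fun t => rC (g t)) @ F --> rC l.
Proof.
move=> /cvgrPdist_le gl; apply/cvgrPdist_le => _ /gt0_rC[e e0 ->].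
by apply: filterS (gl e e0) => t; rewrite -rmorphB norm_rC ler_rC.
Qed.

Lemma cvg_re (S : Type) (F : set_system S) {FF : Filter F} (g : S -> CC R) l :
  g @ F --> l -> (fun t => reC (g t)) @ F --> reC l.
Proof.
move=> /cvgrPdist_le gl; apply/cvgrPdist_le => e e0.
have e0' : 0 < rC e by rewrite -rC0 ltr_rC.
by apply: filterS (gl _ e0') => t; rewrite -reCB; exact: reC_le.
Qed.

Lemma cvg_im (S : Type) (F : set_system S) {FF : Filter F} (g : S -> CC R) l :
  g @ F --> l -> (fun t => imC (g t)) @ F --> imC l.
Proof.
move=> /cvgrPdist_le gl; apply/cvgrPdist_le => e e0.
have e0' : 0 < rC e by rewrite -rC0 ltr_rC.
by apply: filterS (gl _ e0') => t; rewrite -imCB; exact: imC_le.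
Qed.

(** The limits of the two parts are enough for the existence of a complex limit;
    this is how the monotone convergence of real functions is brought to bear on
    complex curves. *)
Lemma cvg_CC (S : Type) (F : set_system S) {FF : Filter F} (g : S -> CC R)
    (a b : R) :
  (fun t => reC (g t)) @ F --> a -> (fun t => imC (g t)) @ F --> b ->
  cvg (g @ F).
Proof.
move=> ga gb.
have [I E] : exists I : CC R, forall z : CC R, z = rC (reC z) + I * rC (imC z).
  by exists (Complex 0 1 : R[i]) => z; exact: (@complexE R z).
apply/cvg_ex; exists (rC a + I * rC b).
have -> : g = (fun t => rC (reC (g t)) + I * rC (imC (g t))).
  by apply/funext => t; exact: E.
apply: cvgD; first exact: cvg_rC.
by apply: cvgM; [exact: cvg_cst|exact: cvg_rC].
Qed.

Lemma cvg_mx_entries (S : Type) (F : set_system S) {FF : Filter F} m n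
   (f : S -> 'M[CC R]_(m, n)) (l : 'M[CC R]_(m, n)) :
  (forall i j, (fun t => f t i j) @ F --> l i j) -> f @ F --> l.
Proof.
move=> fl; apply/cvgrPdist_le => e e0.
have H : \forall t \near F, forall p : 'I_m * 'I_n, `|l p.1 p.2 - f t p.1 p.2| <= e.
  apply: filter_forall => p.
  by move/cvgrPdist_le : (fl p.1 p.2); apply.
apply: filterS H => t Ht; apply/mx_norm_leP; first exact: ltW.
by move=> i j; rewrite !mxE; apply: (Ht (i, j)).
Qed.

Lemma cvg_mx_entry (S : Type) (F : set_system S) {FF : Filter F} m n
   (f : S -> 'M[CC R]_(m, n)) (l : 'M[CC R]_(m, n)) i j :
   f @ F --> l -> (fun t => f t i j) @ F --> l i j.
Proof.
move=> /cvgrPdist_le fl; apply/cvgrPdist_le => e e0.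
apply: filterS (fl e e0) => t /mx_norm_leP; rewrite ltW// => /(_ isT i j).
by rewrite !mxE.
Qed.

Lemma deriv_within_cst A c s : deriv_within A (fun=> c) s 0.
Proof.
apply: HasD; under eq_fun do rewrite subrr mulr0.
exact: cvg_cst.
Qed.

Lemma deriv_withinD A f g s l k :
  deriv_within A f s l -> deriv_within A g s k ->
  deriv_within A (fun t => f t + g t) s (l + k).
Proof.
move=> [fl] [gk]; apply: HasD.
have -> : (fun t => rC (t - s)^-1 * (f t + g t - (f s + g s))) =
  (fun t => rC (t - s)^-1 * (f t - f s) + rC (t - s)^-1 * (g t - g s)).
  by apply/funext => t; ring.
by apply: cvgD; [exact: fl|exact: gk].
Qed.

Lemma deriv_within_cont A f s l : deriv_within A f s l -> f @ within A s^' --> f s.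
Proof.
move=> [fl].
have c : (fun t => rC (t - s) * (rC (t - s)^-1 * (f t - f s)) + f s) @
    within A s^' --> rC 0 * l + f s.
  apply: cvgD; last exact: cvg_cst.
  apply: cvgM; last exact: fl.
  apply: cvg_rC; rewrite -[X in _ --> X](subrr s).
  apply: cvgB; last exact: cvg_cst.
  by move=> U nU; apply: cvg_within; apply: cvg_within.
rewrite rmorph0 mul0r add0r in c.
apply: cvg_trans c; apply: near_eq_cvg.
have ne : \forall t \near within A s^', t != s.
  by apply: cvg_within; exact: withinT.
near=> t; have ts : t != s by near: t.
by rewrite mulrA -rmorphM mulfV ?subr_eq0// rmorph1 mul1r subrK.
Unshelve. all: by end_near.
Qed.

Lemma deriv_withinM A f g s l k :
  deriv_within A f s l -> deriv_within A g s k ->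
  deriv_within A (fun t => f t * g t) s (l * g s + f s * k).
Proof.
move=> [fl] [gk]; apply: HasD.
have -> : (fun t => rC (t - s)^-1 * (f t * g t - f s * g s)) =
  (fun t => (rC (t - s)^-1 * (f t - f s)) * g s + f t * (rC (t - s)^-1 * (g t - g s))).
  by apply/funext => t; ring.
apply: cvgD; first by apply: cvgM; [exact: fl|exact: cvg_cst].
by apply: cvgM; [exact: deriv_within_cont (HasD fl)|exact: gk].
Qed.
End Deriv.

Section Deriv2.
Variable R : realType.
Implicit Types (A B : set R) (f g : R -> CC R) (s : R).

Lemma deriv_within_sub A B f s l : A `<=` B ->
  deriv_within B f s l -> deriv_within A f s l.
Proof.
move=> AB [fl]; apply: HasD => U Uf; have := fl U Uf.
apply: (@filterS _ s^') => t h At; exact: h (AB _ At).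
Qed.

Lemma deriv_within_sum A s (I : Type) (r : seq I) (P : pred I) (f : I -> R -> CC R) l :
  (forall i, P i -> deriv_within A (f i) s (l i)) ->
  deriv_within A (fun t => \sum_(i <- r | P i) f i t) s (\sum_(i <- r | P i) l i).
Proof.
move=> H; elim: r => [|i r IH].
  rewrite big_nil; have -> : (fun t => \sum_(i <- [::] | P i) f i t) = fun=> 0.
    by apply/funext => t; rewrite big_nil.
  exact: deriv_within_cst.
rewrite big_cons; have -> : (fun t => \sum_(i <- i :: r | P i) f i t) =
    fun t => if P i then f i t + \sum_(i <- r | P i) f i t else \sum_(i <- r | P i) f i t.
  by apply/funext => t; rewrite big_cons.
by case: ifP => // Pi; apply: deriv_withinD => //; exact: H.
Qed.

Lemma reC_rC (x : R) : reC (rC x) = x. Proof. by []. Qed.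

Lemma near_dnbhs_shift (P : set R) s :
  (\forall t \near s^', P (t - s)) <-> (\forall h \near 0^', P h).
Proof.
rewrite /dnbhs; split.
  move=> /nbhs0P H; apply: (@filterS _ (nbhs (0 : R))) H => h /= H h0.
  by have := H; rewrite addrAC subrr add0r; apply; rewrite -subr_eq0 addrAC subrr add0r.
move=> H; apply: ((nbhs0P (fun t => t != s -> P (t - s)) s).2).
apply: (@filterS _ (nbhs (0 : R))) H => h /= H h0.
rewrite addrAC subrr add0r; apply: H.
by move: h0; rewrite -subr_eq0 addrAC subrr add0r.
Qed.

(** Real calculus enters through [rC]: a real function is differentiated as a
    complex curve, so that the rules for sums and products serve both. *)
Lemma deriv_within_rC A (f : R -> R) s l : is_derive s 1 f l ->
  deriv_within A (fun t => rC (f t)) s (rC l).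
Proof.
move=> [df <-]; apply: HasD.
have -> : (fun t => rC (t - s)^-1 * (rC (f t) - rC (f s))) =
  (fun t => rC ((t - s)^-1 * (f t - f s))).
  by apply/funext => t; rewrite !rmorphM rmorphB.
apply: cvg_rC.
apply: (@cvg_trans _ ((fun t => (t - s)^-1 * (f t - f s)) @ s^')).
  by apply: cvg_app; exact: cvg_within.
move=> U /df H.
have := (near_dnbhs_shift _ s).2 H.
apply: (@filterS _ s^') => t /=.
by rewrite /GRing.scale /= mulr1 subrK.
Qed.

Lemma deriv_within_derive A (f : R -> R) s l : nbhs s A ->
  deriv_within A (fun t => rC (f t)) s (rC l) -> is_derive s 1 f l.
Proof.
move=> nA [fl].
have c : (fun h : R => h^-1 *: (f (h *: (1 : R) + s) - f s)) @ 0^' --> l.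
  move=> U Ul; apply: (near_dnbhs_shift _ s).1.
  have E : (fun t => reC (rC (t - s)^-1 * (rC (f t) - rC (f s)))) =
      (fun t => (t - s)^-1 * (f t - f s)).
    by apply/funext => t; rewrite reCM -rmorphB.
  have : (fun t => reC (rC (t - s)^-1 * (rC (f t) - rC (f s)))) @ within A s^' --> reC (rC l).
    exact: cvg_re fl.
  rewrite reC_rC E => /(_ U Ul) H.
  have {}nA : \forall t \near s^', A t by exact: cvg_within.
  apply: (@filterS2 _ s^') nA H => t At /(_ At).
  by rewrite /= /GRing.scale /= mulr1 subrK.
by apply: DeriveDef; [apply/cvg_ex; exists l|apply: cvg_lim].
Qed.

Lemma deriv_within_re A f s l : deriv_within A f s l ->
  deriv_within A (fun t => rC (reC (f t))) s (rC (reC l)).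
Proof.
move=> [fl]; apply: HasD.
have -> : (fun t => rC (t - s)^-1 * (rC (reC (f t)) - rC (reC (f s)))) =
  (fun t => rC (reC (rC (t - s)^-1 * (f t - f s)))).
  by apply/funext => t; rewrite reCM reCB rmorphM rmorphB.
by apply: cvg_rC; apply: cvg_re; exact: fl.
Qed.

Lemma deriv_within_im A f s l : deriv_within A f s l ->
  deriv_within A (fun t => rC (imC (f t))) s (rC (imC l)).
Proof.
move=> [fl]; apply: HasD.
have -> : (fun t => rC (t - s)^-1 * (rC (imC (f t)) - rC (imC (f s)))) =
  (fun t => rC (imC (rC (t - s)^-1 * (f t - f s)))).
  by apply/funext => t; rewrite imCM imCB rmorphM rmorphB.
by apply: cvg_rC; apply: cvg_im; exact: fl.
Qed.

Lemma deriv_within_within_continuous A (f df : R -> R) :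
  (forall s, A s -> deriv_within A (fun t => rC (f t)) s (rC (df s))) ->
  {within A, continuous f}.
Proof.
move=> H; apply/subspace_continuousP => s As.
have c : reC (rC (f t)) @[t --> within A s^'] --> reC (rC (f s)).
  exact: cvg_re (deriv_within_cont (H s As)).
move=> U fU; have := c U fU.
apply: (@filterS _ (nbhs (s : R))) => t h At.
have [->|ts] := eqVneq t s; first exact: (nbhs_singleton fU).
exact: h.
Qed.

(** The interval is closed at [b], where only a one-sided derivative exists;
    continuity inside the set suffices there. *)
Lemma deriv_within_mono (b : R) (f df : R -> R) :
  (forall s, 0 < s <= b ->
    deriv_within [set t | 0 < t <= b] (fun t => rC (f t)) s (rC (df s))) ->
  (forall s, 0 < s <= b -> 0 <= df s) ->
  forall x y, 0 < x -> x <= y -> y <= b -> f x <= f y.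
Proof.
move=> Hf df0 x y x0 xy yb.
have Hd s : x < s < b -> is_derive s 1 f (df s).
  move=> /andP[xs sb]; apply: (@deriv_within_derive [set t | 0 < t <= b]); last first.
    by apply: Hf; rewrite (lt_trans x0 xs) ltW.
  have : nbhs s `]0, b[%classic.
    by apply: near_in_itvoo; rewrite in_itv /= (lt_trans x0 xs).
  by apply: filterS => t; rewrite /= in_itv /= => /andP[-> /ltW ->].
apply: (@ger0_derive1_ndecr _ f x b) => //.
- by move=> s; rewrite in_itv /= => /Hd [].
- move=> s; rewrite in_itv /= => sI; rewrite derive1E.
  case: (Hd s sI) => _ ->; apply: df0; case/andP: sI => xs sb.
  by rewrite (lt_trans x0 xs) ltW.
- have c := deriv_within_within_continuous Hf.
  apply: continuous_subspaceW c => t; rewrite /= in_itv /= => /andP[xt ->].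
  by rewrite (lt_le_trans x0 xt).
Qed.
End Deriv2.

(** * Gronwall's inequality down to a singular time *)

Section Gronwall.
Variables (R : realType) (n : nat).
Implicit Types (v : 'cV[CC R]_n).

(** A smooth substitute for the supremum norm, comparable to it. *)
Definition energy v : R := \sum_i (reC (v i 0) ^+ 2 + imC (v i 0) ^+ 2).

Lemma energy_ge0 v : 0 <= energy v.
Proof. by apply: sumr_ge0 => i _; rewrite addr_ge0 ?sqr_ge0. Qed.

Lemma normC_sqrt_energy v i : `|v i 0| <= rC (Num.sqrt (energy v)).
Proof.
rewrite normC_rC ler_rC ler_wsqrtr // /energy (bigD1 i) //= lerDl.
by apply: sumr_ge0 => j _; rewrite addr_ge0 ?sqr_ge0.
Qed.

Lemma energy_le v c : 0 <= c -> (forall i, `|v i 0| <= rC c) ->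
  energy v <= n%:R * c ^+ 2.
Proof.
move=> c0 vc; rewrite /energy mulr_natl -[n in leRHS](card_ord n) -sumr_const.
apply: ler_sum => i _; have := vc i; rewrite normC_rC ler_rC => h.
rewrite -(@ler_sqrt _ _ (c ^+ 2)) ?sqr_ge0 //.
by rewrite sqrtr_sqr ger0_norm.
Qed.

(** [g] bounds the growth rate of [W] and may be singular at 0; only the bound
    [M] on its primitive [G] enters
    the conclusions. *)
Variables (b : R) (W dW : R -> 'cV[CC R]_n) (G g : R -> R) (M : R).
Let A := [set t : R | 0 < t <= b].
Hypothesis b_gt0 : 0 < b.
Hypothesis W_dW : forall s, 0 < s <= b -> forall i,
  deriv_within A (fun t => W t i 0) s (dW s i 0).
Hypothesis dW_le : forall s c, 0 < s <= b -> (forall j, `|W s j 0| <= rC c) ->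
  forall i, `|dW s i 0| <= rC (g s * c).
Hypothesis G_g : forall s, 0 < s <= b -> is_derive s 1 G (g s).
Hypothesis g_ge0 : forall s, 0 < s <= b -> 0 <= g s.
Hypothesis G_bd : forall s, 0 < s <= b -> 0 <= G s <= M.

Let E s := energy (W s).
Let dE s : R := \sum_i 2 * (reC (W s i 0) * reC (dW s i 0)
                    + imC (W s i 0) * imC (dW s i 0)).

Let E_dE s : 0 < s <= b -> deriv_within A (fun t => rC (E t)) s (rC (dE s)).
Proof.
move=> sb.
have -> : (fun t => rC (E t)) = (fun t => \sum_i
  (rC (reC (W t i 0)) * rC (reC (W t i 0)) + rC (imC (W t i 0)) * rC (imC (W t i 0)))).
  apply/funext => t; rewrite /E /energy rmorph_sum.
  by apply: eq_bigr => i _; rewrite rmorphD !rmorphXn !expr2.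
rewrite /dE rmorph_sum; apply: deriv_within_sum => i _.
have h1 := deriv_within_re (W_dW sb i); have h2 := deriv_within_im (W_dW sb i).
have := deriv_withinD (deriv_withinM h1 h1) (deriv_withinM h2 h2).
congr deriv_within; rewrite -!rmorphM -!rmorphD; congr rC; ring.
Qed.

Let dE_le s : 0 < s <= b -> `|dE s| <= (4 * n%:R) * g s * E s.
Proof.
move=> sb; set c := Num.sqrt (E s).
have hW j : `|W s j 0| <= rC c by exact: normC_sqrt_energy.
have hd := dW_le sb hW.
have c0 : 0 <= c by exact: sqrtr_ge0.
have -> : E s = c ^+ 2 by rewrite sqr_sqrtr // energy_ge0.
apply: le_trans (ler_norm_sum _ _ _) _.
apply: (@le_trans _ _ (\sum_(i < n) (4 * (g s * c ^+ 2)))); last first.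
  by rewrite sumr_const card_ord -mulr_natl le_eqVlt; apply/orP; left; apply/eqP; ring.
apply: ler_sum => i _.
rewrite normrM ger0_norm //.
have -> : 4 * (g s * c ^+ 2) = 2 * (c * (g s * c) + c * (g s * c)) by ring.
rewrite ler_wpM2l //; apply: le_trans (ler_normD _ _) _; rewrite !normrM.
by apply: lerD; apply: ler_pM => //;
  [exact: reC_le|exact: reC_le|exact: imC_le|exact: imC_le].
Qed.

(** The energy e of W satisfies |e'| <= 4 n g e, so that e exp(4 n G) increases
    and e exp(- 4 n G) decreases; this compares e at two times in either
    order. *)
Lemma gronwall_energy s t : 0 < s <= b -> 0 < t <= b ->
  energy (W s) <= expR (4 * n%:R * M) * energy (W t).
Proof.
have weighted (k : R) x : 0 < x <= b ->
    deriv_within A (fun t => rC (E t * expR (k * G t))) x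
      (rC ((dE x + k * g x * E x) * expR (k * G x))).
  move=> xb; have h := E_dE xb.
  have hk : is_derive x 1 (fun t => expR (k * G t)) (k * g x * expR (k * G x)).
    have h1 := G_g xb.
    have h2 : is_derive x 1 (fun t => k * G t) (k * g x) by exact: is_deriveZ.
    have h3 := @is_derive1_comp _ expR (fun t => k * G t) x _ _ (is_derive_expR _) h2.
    by apply: (is_derive_eq h3); rewrite mulrC.
  have := deriv_withinM h (deriv_within_rC A hk).
  under eq_fun do rewrite -rmorphM.
  by congr deriv_within; rewrite -!rmorphM -rmorphD; congr rC; ring.
have K0 : 0 <= 4 * n%:R :> R by rewrite mulr_ge0.
have up x y : 0 < x -> x <= y -> y <= b ->
    E x * expR (4 * n%:R * G x) <= E y * expR (4 * n%:R * G y).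
  apply: (deriv_within_mono (weighted _)) => z zb; rewrite mulr_ge0 ?expR_ge0 //.
  by have := dE_le zb; rewrite ler_norml => /andP[]; lra.
have dn x y : 0 < x -> x <= y -> y <= b ->
    E y * expR (- (4 * n%:R) * G y) <= E x * expR (- (4 * n%:R) * G x).
  move=> x0 xy yb; rewrite -lerN2.
  pose f x := - (E x * expR (- (4 * n%:R) * G x)); rewrite -/(f x) -/(f y).
  have wN z : 0 < z <= b -> deriv_within A (fun t => rC (f t)) z
     (rC (- ((dE z + - (4 * n%:R) * g z * E z) * expR (- (4 * n%:R) * G z)))).
    move=> zb.
    have := deriv_withinM (deriv_within_cst A (rC (-1)) z) (weighted (- (4 * n%:R)) z zb).
    under eq_fun do rewrite -rmorphM mulN1r.
    by congr deriv_within; rewrite mul0r add0r -rmorphM mulN1r.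
  apply: (deriv_within_mono wN) => // z zb; rewrite -mulNr mulr_ge0 ?expR_ge0 //.
  by have := dE_le zb; rewrite ler_norml => /andP[]; lra.
move=> sb tb; rewrite -/(E s) -/(E t).
have [Gs0 GsM] := andP (G_bd sb); have [Gt0 GtM] := andP (G_bd tb).
have [st|/ltW ts] := leP s t.
- have := up s t; case/andP: sb => -> _; case/andP: tb => _ -> /(_ isT st isT) h.
  rewrite mulrC; apply: le_trans (_ : E t * expR (4 * n%:R * G t) <= _); last first.
    by rewrite ler_wpM2l ?energy_ge0 // ler_expR ler_wpM2l.
  apply: le_trans h; rewrite ler_peMr ?energy_ge0 //.
  by rewrite -expR0 ler_expR mulr_ge0.
- have := dn t s; case/andP: tb => -> _; case/andP: sb => _ -> /(_ isT ts isT) h.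
  rewrite -(@ler_pM2r _ (expR (- (4 * n%:R) * G s))) ?expR_gt0 //.
  apply: le_trans h _; rewrite mulrAC -expRD [leRHS]mulrC.
  rewrite ler_wpM2l ?energy_ge0 // ler_expR.
  have : 4 * n%:R * (G s) <= 4 * n%:R * M by rewrite ler_wpM2l.
  have : 0 <= 4 * n%:R * G t by rewrite mulr_ge0.
  lra.
Qed.

(** Each real or imaginary part f of an entry satisfies |f'| <= c g, where c is
    the bound given by [gronwall_energy]. Then f + c G is nondecreasing and
    bounded below, hence has a limit at 0, as does G itself. *)
Lemma gronwall_cvg : cvg (W @ 0^'+).
Proof.
have bb : 0 < b <= b by rewrite b_gt0 lexx.
set c := Num.sqrt (expR (4 * n%:R * M) * E b).
have Wc s : 0 < s <= b -> forall j, `|W s j 0| <= rC c.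
  move=> sb j; apply: le_trans (normC_sqrt_energy _ _) _.
  by rewrite ler_rC ler_wsqrtr // gronwall_energy.
have c0 : 0 <= c by exact: sqrtr_ge0.
have mono (h dh : R -> R) (m : R) :
    (forall s, 0 < s <= b -> deriv_within A (fun t => rC (h t)) s (rC (dh s))) ->
    (forall s, 0 < s <= b -> 0 <= dh s) ->
    (forall s, 0 < s <= b -> m <= h s) -> cvg (h @ 0^'+).
  move=> Hh dh0 hm; apply/cvg_ex; eexists.
  apply: (@nondecreasing_at_right_cvgr _ h 0 (BRight b)).
  - by rewrite bnd_simp.
  - move=> y z; rewrite !in_itv /= => /andP[y0 yb] /andP[z0 zb].
    by move=> yz; apply: (deriv_within_mono Hh dh0).
  - by exists m => x [y]; rewrite /= in_itv /= => yb <-; exact: hm.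
have cG : cvg (G @ 0^'+).
  apply: (mono G g 0) => [s sb|//|s sb]; first by apply: deriv_within_rC; exact: G_g.
  by case/andP: (G_bd sb).
have mono_cvg (f df : R -> R) :
   (forall s, 0 < s <= b -> deriv_within A (fun t => rC (f t)) s (rC (df s))) ->
   (forall s, 0 < s <= b -> `|df s| <= g s * c) ->
   (forall s, 0 < s <= b -> `|f s| <= c) -> cvg (f @ 0^'+).
  move=> Hf Hdf fc.
  have cfG : cvg ((fun t => f t + c * G t) @ 0^'+).
    apply: (mono _ (fun t => df t + c * g t) (- c)) => s sb.
    - have := deriv_withinD (Hf s sb)
        (deriv_withinM (deriv_within_cst A (rC c) s) (deriv_within_rC A (G_g sb))).
      under eq_fun do rewrite -rmorphM -rmorphD.
      by congr deriv_within; rewrite mul0r add0r rmorphD rmorphM.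
    - by have := Hdf s sb; rewrite ler_norml => /andP[]; lra.
    - have := fc s sb; rewrite ler_norml => /andP[h _].
      by case/andP: (G_bd sb) => G0 _; rewrite -[leLHS]addr0 lerD // mulr_ge0.
  have -> : f = (fun t => (f t + c * G t) - c * G t).
    by apply/funext => t; rewrite addrK.
  apply: is_cvgB; first exact: cfG.
  by apply: is_cvgM; [exact: is_cvg_cst|exact: cG].
have cW i : cvg ((fun t => W t i 0) @ 0^'+).
  have h s (sb : 0 < s <= b) := dW_le sb (Wc s sb) i.
  apply: (@cvg_CC R R _ _ _ (lim ((fun t => reC (W t i 0)) @ 0^'+))
    (lim ((fun t => imC (W t i 0)) @ 0^'+))).
  - apply: (mono_cvg _ (fun t => reC (dW t i 0))) => s sb.
    + exact: deriv_within_re (W_dW sb i).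
    + exact: reC_le (h s sb).
    + exact: reC_le (Wc s sb i).
  - apply: (mono_cvg _ (fun t => imC (dW t i 0))) => s sb.
    + exact: deriv_within_im (W_dW sb i).
    + exact: imC_le (h s sb).
    + exact: imC_le (Wc s sb i).
apply/cvg_ex; exists (\col_i lim ((fun t => W t i 0) @ 0^'+)).
by apply: cvg_mx_entries => i j; rewrite ord1 mxE; exact: cW.
Qed.

Lemma cvg_energy (l : 'cV[CC R]_n) : W @ 0^'+ --> l ->
  (fun t => energy (W t)) @ 0^'+ --> energy l.
Proof.
move=> Wl; apply: cvg_big => [|i _]; first exact: add_continuous.
have h : (fun t => W t i 0) @ 0^'+ --> l i 0 by exact: cvg_mx_entry Wl.
apply: cvgD; apply: cvgM.
- exact: cvg_re h.
- exact: cvg_re h.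
- exact: cvg_im h.
- exact: cvg_im h.
Qed.

Lemma gronwall_energy_lim (s t : R) : 0 <= s <= b -> 0 <= t <= b ->
  energy (if s == 0 then lim (W @ 0^'+) else W s) <=
    expR (4 * n%:R * M) * energy (if t == 0 then lim (W @ 0^'+) else W t).
Proof.
move=> /andP[s0 sb] /andP[t0 tb]; set W0 := lim _.
have cE := cvg_energy gronwall_cvg; rewrite -/W0 in cE.
have P (r : R) : 0 < r <= b -> energy W0 <= expR (4 * n%:R * M) * energy (W r) /\
     energy (W r) <= expR (4 * n%:R * M) * energy W0.
  move=> rb; split.
    rewrite -(cvg_lim _ cE) //; apply: limr_le; first by apply/cvg_ex; eexists; exact: cE.
    near=> x; apply: gronwall_energy => //.
    by apply/andP; split; near: x; [exact: nbhs_right_gt|exact: nbhs_right_le].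
  have cKE : (fun t => expR (4 * n%:R * M) * energy (W t)) @ 0^'+ -->
      expR (4 * n%:R * M) * energy W0.
    by apply: cvgM; [exact: cvg_cst|exact: cE].
  rewrite -(cvg_lim _ cKE) //; apply: limr_ge; first by apply/cvg_ex; eexists; exact: cKE.
  near=> x; apply: gronwall_energy => //.
  by apply/andP; split; near: x; [exact: nbhs_right_gt|exact: nbhs_right_le].
have M0 : 0 <= M.
  have : 0 < b <= b by rewrite b_gt0 lexx.
  by move=> /G_bd /andP[]; exact: le_trans.
have [_|sn] := eqVneq s 0; have [_|tn] := eqVneq t 0.
- by rewrite ler_peMl ?energy_ge0 // -expR0 ler_expR !mulr_ge0.
- by apply: (P t _).1; rewrite lt_neqAle eq_sym tn t0.
- by apply: (P s _).2; rewrite lt_neqAle eq_sym sn s0.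
- by apply: gronwall_energy; rewrite lt_neqAle eq_sym ?sn ?tn ?s0 ?t0.
Unshelve. all: by end_near.
Qed.
End Gronwall.

(** * The exponential of a diagonal matrix plus a nilpotent one *)

Section MatrixExponential.
Variables (R : realType) (n : nat) (lam : 'I_n.+1 -> R) (Nil : 'M[CC R]_n.+1).

Definition rdiag_mx (f : 'I_n.+1 -> R) : 'M[CC R]_n.+1 := diag_mx (\row_i rC (f i)).

Lemma rdiag_mxE f i j : rdiag_mx f i j = rC (f i) *+ (i == j).
Proof. by rewrite /rdiag_mx !mxE. Qed.

Lemma rdiag_mxM f g : rdiag_mx f *m rdiag_mx g = rdiag_mx (fun i => f i * g i).
Proof.
apply/matrixP => i j; rewrite mul_diag_mx !mxE rmorphM -mulrnAr.
by [].
Qed.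

Hypothesis lam_Nil : rdiag_mx lam *m Nil = 0.
Hypothesis Nil_lam : Nil *m rdiag_mx lam = 0.
Hypothesis Nil_Nil : Nil *m Nil = 0.

(** The mixed products vanish, and the nilpotent part only contributes to the
    first power. *)
Lemma diag_nil_exp (x : R) k :
  (rC x *: (rdiag_mx lam + Nil)) ^+ k =
  rdiag_mx (fun i => (x * lam i) ^+ k) + rC x *: Nil *+ (k == 1)%N.
Proof.
have xl : rC x *: rdiag_mx lam = rdiag_mx (fun i => x * lam i).
  by apply/matrixP => i j; rewrite !mxE mulrnAr rmorphM.
have NX m : Nil *m rdiag_mx (fun i => (x * lam i) ^+ m.+1) = 0.
  have -> : rdiag_mx (fun i => (x * lam i) ^+ m.+1) =
    rC x *: (rdiag_mx lam *m rdiag_mx (fun i => (x * lam i) ^+ m)).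
    rewrite rdiag_mxM; apply/matrixP => i j; rewrite !mxE mulrnAr -rmorphM mulrA -exprS.
    by [].
  by rewrite -scalemxAr mulmxA Nil_lam mul0mx scaler0.
elim: k => [|k IH].
  rewrite expr0 addr0; apply/matrixP => i j; rewrite !mxE expr0 rmorph1.
  by [].
rewrite exprS IH mulrDr scalerDr xl.
rewrite -![_ * _]/(_ *m _) !mulmxDl rdiag_mxM.
have -> : rdiag_mx (fun i => x * lam i * (x * lam i) ^+ k) =
    rdiag_mx (fun i => (x * lam i) ^+ k.+1).
  by apply/matrixP => i j; rewrite !mxE exprS.
rewrite -addrA; congr (_ + _).
case: k IH => [|k] IH.
  rewrite /= !mulr0n !mulmx0 !addr0.
  have -> : rdiag_mx (fun i => (x * lam i) ^+ 0) = 1%:M.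
    by apply/matrixP => i j; rewrite !mxE expr0 rmorph1.
  by rewrite mulmx1.
rewrite -scalemxAl NX scaler0 add0r /= mulr0n.
case: k IH => [|k] _ /=; rewrite ?mulr0n ?mulmx0 ?addr0 // mulr1n -scalemxAr -xl.
by rewrite -!scalemxAl lam_Nil -scalemxAr Nil_Nil !scaler0 addr0.
Qed.

Lemma expmx_diag_nil (x : R) :
  expmx (rC x *: (rdiag_mx lam + Nil)) = 
    rdiag_mx (fun i => expR (x * lam i)) + rC x *: Nil.
Proof.
apply: cvg_lim; first exact: norm_hausdorff.
apply: cvg_mx_entries => i j.
have -> : (fun m => series (fun k : nat =>
      (k`!%:R)^-1 *: (rC x *: (rdiag_mx lam + Nil)) ^+ k) m i j) =
   (fun m => rC (series (exp_coeff (x * lam i)) m) *+ (i == j) +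
       (rC x * Nil i j) *+ (1 < m)%N).
  apply/funext => m; rewrite /series /= summxE.
  elim: m => [|m IH].
    by rewrite !big_geq // rmorph0 mul0rn addr0.
  rewrite !big_nat_recr //= IH diag_nil_exp.
  set y := x * lam i; set a := rC x * Nil i j.
  have -> : ((m`!%:R)^-1 *: (rdiag_mx (fun i0 => (x * lam i0) ^+ m)
        + rC x *: Nil *+ (m == 1)%N)) i j
      = (m`!%:R)^-1 * (rC (y ^+ m) *+ (i == j) + a *+ (m == 1)%N).
    by rewrite mxE; congr (_ * _); rewrite mxE rdiag_mxE mulmxnE mxE.
  have -> : rC (\sum_(0 <= k < m) exp_coeff y k + exp_coeff y m) *+ (i == j) =
      rC (\sum_(0 <= k < m) exp_coeff y k) *+ (i == j)
      + (m`!%:R)^-1 * (rC (y ^+ m) *+ (i == j)).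
    rewrite rmorphD mulrnDl; congr (_ + _); rewrite /exp_coeff /=.
    by rewrite rmorphM fmorphV rmorph_nat mulrnAr mulrC.
  have -> : a *+ (1 < m.+1)%N = a *+ (1 < m)%N + (m`!%:R)^-1 * (a *+ (m == 1)%N).
    case: m {IH} => [|[|m]] /=; rewrite ?mulr0n ?mulr0 ?addr0 //.
    by rewrite factS fact0 add0r !mulr1n invr1 mul1r.
  by rewrite mulrDr addrACA.
rewrite mxE rdiag_mxE mxE.
apply: cvgD.
  have h : (fun m => rC (series (exp_coeff (x * lam i)) m)) @ \oo --> rC (expR (x * lam i)).
    apply: cvg_rC; exact: is_cvg_series_exp_coeff.
  case: (i == j); last exact: cvg_cst.
  exact: h.
by apply: cvg_near_cst; exists 2%N => // m /= h; rewrite h mulr1n.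
Qed.

(** The value of exp(y (diag lam + Nil)). *)
Definition exp_jordan (y : R) : 'M[CC R]_n.+1 :=
  rdiag_mx (fun i => expR (y * lam i)) + rC y *: Nil.

Let Nil0 i j : rC (lam i) * Nil i j = 0.
Proof.
by move/matrixP: lam_Nil => /(_ i j); rewrite mul_diag_mx !mxE.
Qed.

Let Nil0' i j : Nil i j * rC (lam j) = 0.
Proof.
by move/matrixP: Nil_lam => /(_ i j); rewrite mul_mx_diag !mxE.
Qed.

Let expNil y : rdiag_mx (fun i => expR (y * lam i)) *m Nil = Nil.
Proof.
apply/matrixP => i j; rewrite mul_diag_mx !mxE.
have /eqP := Nil0 i j; rewrite mulf_eq0 => /orP[|/eqP ->]; last by rewrite mulr0.
by rewrite fmorph_eq0 => /eqP ->; rewrite mulr0 expR0 rmorph1 mul1r.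
Qed.

Let Nilexp y : Nil *m rdiag_mx (fun i => expR (y * lam i)) = Nil.
Proof.
apply/matrixP => i j; rewrite mul_mx_diag !mxE.
have /eqP := Nil0' i j; rewrite mulf_eq0 => /orP[/eqP ->|]; first by rewrite mul0r.
by rewrite fmorph_eq0 => /eqP ->; rewrite mulr0 expR0 rmorph1 mulr1.
Qed.

Lemma exp_jordanD y z : exp_jordan y *m exp_jordan z = exp_jordan (y + z).
Proof.
rewrite /exp_jordan mulmxDl !mulmxDr rdiag_mxM -!scalemxAl -!scalemxAr.
rewrite Nil_Nil !scaler0 addr0.
rewrite expNil Nilexp -addrA rmorphD scalerDl [rC z *: _ + _]addrC.
congr (_ + _); apply/matrixP => i j; rewrite !rdiag_mxE -expRD mulrDl.
by [].
Qed.

Lemma exp_jordan0 : exp_jordan 0 = 1%:M.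
Proof.
rewrite /exp_jordan rmorph0 scale0r addr0; apply/matrixP => i j.
by rewrite rdiag_mxE !mxE mul0r expR0 rmorph1.
Qed.

Lemma exp_jordan_mulB y :
  exp_jordan y *m (rdiag_mx lam + Nil) =
    rdiag_mx (fun i => lam i * expR (y * lam i)) + Nil.
Proof.
rewrite /exp_jordan mulmxDl !mulmxDr rdiag_mxM -!scalemxAl Nil_Nil Nil_lam !scaler0 !addr0.
rewrite expNil; congr (_ + _).
by apply/matrixP => i j; rewrite !rdiag_mxE mulrC.
Qed.

Lemma deriv_within_exp_jordan (A : set R) (y : R -> R) (s dy : R) :
  is_derive s 1 y dy -> forall i j,
  deriv_within A (fun t => exp_jordan (y t) i j) s
    ((rC dy *: (exp_jordan (y s) *m (rdiag_mx lam + Nil))) i j).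
Proof.
move=> yd i j; rewrite exp_jordan_mulB.
have h1 : is_derive s 1 (fun t => expR (y t * lam i)) (dy * lam i * expR (y s * lam i)).
  have h2 : is_derive s 1 (fun t => lam i * y t) (lam i * dy) by exact: is_deriveZ.
  have := @is_derive1_comp _ expR (fun t => lam i * y t) s _ _ (is_derive_expR _) h2.
  rewrite mulrC (mulrC (lam i) dy) [lam i * _]mulrC.
  by congr is_derive; apply/funext => t /=; rewrite mulrC.
have h := deriv_withinD
    (deriv_withinM (deriv_within_rC A h1) (deriv_within_cst A ((i == j)%:R) s))
    (deriv_withinM (deriv_within_rC A yd) (deriv_within_cst A (Nil i j) s)).
have -> : (fun t => exp_jordan (y t) i j) =
   (fun t => rC (expR (y t * lam i)) * (i == j)%:R + rC (y t) * Nil i j).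
  by apply/funext => t; rewrite /exp_jordan mxE rdiag_mxE mxE mulr_natr.
move: h; congr deriv_within; rewrite !mulr0 !addr0 mxE mxE rdiag_mxE mulrDr; congr (_ + _).
by rewrite mulr_natr mulrnAr -!rmorphM mulrA.
Qed.

(** The diagonal exponentials commute with [D] and fix [Nil] on both sides, so
    that they cancel: no power of exp(y lam) survives. *)
Lemma exp_jordan_conj_diag y (D : 'M[CC R]_n.+1) : is_diag_mx D ->
  exp_jordan y *m D *m exp_jordan (- y) =
  D + rC y *: (Nil *m D - D *m Nil) - rC (y ^+ 2) *: (Nil *m D *m Nil).
Proof.
move=> Dd.
have cD f : rdiag_mx f *m D = D *m rdiag_mx f.
  apply/matrixP => i j; rewrite mul_diag_mx mul_mx_diag !mxE.
  case: (eqVneq i j) => [->|ij]; first by rewrite mulrC.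
  by move/is_diag_mxP : Dd => ->; rewrite ?mulr0 ?mul0r.
have PP : rdiag_mx (fun i => expR (y * lam i)) *m
    rdiag_mx (fun i => expR (- y * lam i)) = 1%:M.
  rewrite rdiag_mxM; apply/matrixP => i j.
  rewrite rdiag_mxE !mxE -expRD -mulrDl subrr mul0r expR0.
  by rewrite rmorph1.
have e1 : rdiag_mx (fun i => expR (y * lam i)) *m D *m
    rdiag_mx (fun i => expR (- y * lam i)) = D.
  by rewrite cD -mulmxA PP mulmx1.
have e2 : Nil *m D *m rdiag_mx (fun i => expR (- y * lam i)) = Nil *m D.
  by rewrite -mulmxA -cD mulmxA Nilexp.
have e3 : rdiag_mx (fun i => expR (y * lam i)) *m D *m Nil = D *m Nil.
  by rewrite cD -mulmxA expNil.
rewrite /exp_jordan rmorphN scaleNr [in LHS]mulmxDl -[rC y *: Nil *m D]scalemxAl.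
rewrite mulmxDr mulmxN !mulmxDl -!scalemxAl -!scalemxAr e1 e2 e3.
rewrite scalerA -rmorphM -expr2 scalerBr.
set a := rC y *: (Nil *m D); set b := rC y *: _; set c := rC _ *: _.
by rewrite opprD !addrA.
Qed.
End MatrixExponential.

(** * Jordan structure of the matrix BP *)

Section BPStructure.
Variables (R : realType) (d : nat) (ell : 'I_d -> R).
Implicit Types (r c : 'I_(dimP d)).

Lemma eq_block r c : r./2 = c./2 -> block r = block c.
Proof. by move=> rc; rewrite /block rc. Qed.

(** An off-diagonal entry of BP couples the two rows of a block only if the
    exponents of the block vanish; hence the products of [Bdiag] and [Bnil] are
    zero. *)
Definition Bdiag r : R :=
  match block r with
  | Some (i, j) => if odd r then ell i - ell j else ell j - ell i
  | None => 0
  end.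

Definition Bnil : 'M[CC R]_(dimP d) :=
  \matrix_(r, c)
    if (r./2 == c./2) && ~~ odd r && odd c then
      match block r with Some (i, j) => (ell i == ell j)%:R | None => 1 end
    else 0.

Lemma half_odd_inj r c : r./2 = c./2 -> odd r = odd c -> r = c.
Proof.
by move=> h o; apply: val_inj; rewrite /= -(odd_double_half r) -(odd_double_half c) h o.
Qed.

Lemma BP_split : BP ell = rdiag_mx Bdiag + Bnil.
Proof.
apply/matrixP => r c; rewrite !mxE /Bdiag.
case: (eqVneq r./2 c./2) => [h|h] /=; last first.
  by rewrite addr0; case: eqVneq => // rc; rewrite rc eqxx in h.
case: (eqVneq r c) => [->|rc] /=.
  by case: (block c) => [[i j]|]; case: (odd c); rewrite /= ?addr0 /lc ?rmorphB ?rC0.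
have orc : odd r != odd c by apply: contraNneq rc => /half_odd_inj ->.
rewrite add0r; case: (odd r) orc => /=; case: (odd c) => // _; by case: (block r) => [[]|].
Qed.

Lemma Bdiag_Bnil : rdiag_mx Bdiag *m Bnil = 0.
Proof.
apply/matrixP => r c; rewrite mul_diag_mx !mxE /Bdiag.
case: ifP => [/andP[/andP[/eqP h /negbTE or] oc]|]; last by rewrite mulr0.
rewrite or; case: (block r) => [[i j]|]; last by rewrite rC0 mul0r.
by case: eqVneq => [->|_]; rewrite ?mulr0 // subrr rC0 mul0r.
Qed.

Lemma Bnil_Bdiag : Bnil *m rdiag_mx Bdiag = 0.
Proof.
apply/matrixP => r c; rewrite mul_mx_diag !mxE /Bdiag.
case: ifP => [/andP[/andP[/eqP h _] oc]|]; last by rewrite mul0r.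
rewrite (eq_block h) oc; case: (block c) => [[i j]|]; last by rewrite rC0 mulr0.
by case: eqVneq => [->|_]; rewrite ?mul0r // subrr rC0 mulr0.
Qed.

Lemma Bnil_Bnil : Bnil *m Bnil = 0.
Proof.
apply/matrixP => r c; rewrite !mxE big1 // => s _; rewrite !mxE.
by case: (odd s); rewrite /= ?andbF ?andbT /= ?mul0r ?mulr0.
Qed.

Lemma normr_Bnil r c : `|Bnil r c| <= 1.
Proof.
rewrite mxE; case: ifP => _; last by rewrite normr0.
case: (block r) => [[i j]|]; last by rewrite normr1.
by case: eqP; rewrite ?normr1 ?normr0.
Qed.

Lemma EP_exp_jordan x : EP ell x = exp_jordan Bdiag Bnil (- ln (zvar ell x)).
Proof.
rewrite /EP -rmorphN BP_split expmx_diag_nil //.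
- exact: Bdiag_Bnil.
- exact: Bnil_Bdiag.
- exact: Bnil_Bnil.
Qed.
End BPStructure.

(** * The closed linear system for the renormalized unknowns *)

Section LinearSystem.
Variables (R : realType) (d : nat) (ell : 'I_d -> R) (lphi : R).
Implicit Types (x : tpoint R d) (F G : fields R d) (i j : 'I_d).
Local Notation fieldsT := (fields R d).

(** The module operations which the record [fields] does not carry, in the one
    form that linearity needs. *)
Definition flin (k : CC R) F G : fieldsT :=
  Fields (fun i j => k * eta F i j + eta G i j)
         (fun i j => k * kap F i j + kap G i j)
         (k * nu F + nu G) (fun i => k * chi F i + chi G i)
         (k * phi F + phi G) (k * psi F + psi G).

Lemma curv_lin x k F G : curv ell x (flin k F G) = k * curv ell x F + curv ell x G.
Proof.
rewrite /curv mulr_sumr -big_split; apply: eq_bigr => a _.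
by rewrite mulr_sumr -big_split; apply: eq_bigr => b _ /=; ring.
Qed.

Lemma rhs_eta_lin x k F G i j :
  rhs_eta ell x (flin k F G) i j = k * rhs_eta ell x F i j + rhs_eta ell x G i j.
Proof. by rewrite /rhs_eta /=; ring. Qed.

Lemma rhs_kap_lin x k F G i j :
  rhs_kap ell x (flin k F G) i j = k * rhs_kap ell x F i j + rhs_kap ell x G i j.
Proof.
rewrite /rhs_kap; set S := \sum_a _; set S1 := \sum_a _; set S2 := \sum_a _.
have -> : S = k * S1 + S2.
  by rewrite mulr_sumr -big_split; apply: eq_bigr => a _ /=; ring.
by rewrite /=; ring.
Qed.

Lemma rhs_psi_lin x k F G :
  rhs_psi ell lphi x (flin k F G) = k * rhs_psi ell lphi x F + rhs_psi ell lphi x G.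
Proof.
rewrite /rhs_psi; set S := \sum_a _; set S1 := \sum_a _; set S2 := \sum_a _.
have -> : S = k * S1 + S2.
  by rewrite mulr_sumr -big_split; apply: eq_bigr => a _ /=; ring.
by rewrite /=; ring.
Qed.

Lemma UP_lin x k F G : UP ell x (flin k F G) = k *: UP ell x F + UP ell x G.
Proof.
apply/matrixP => r c; rewrite !mxE; case: (block r) => [[i j]|].
  rewrite /Upsbar /bar /=; case: (odd r); first by ring.
  by case: (ell i == ell j); ring.
by case: (odd r).
Qed.

Lemma UP_rate_lin x k F G :
  UP_rate ell lphi x (flin k F G) =
  k *: UP_rate ell lphi x F + UP_rate ell lphi x G.
Proof.
rewrite /UP_rate -UP_lin; congr (UP ell x _); rewrite /flin /=.
congr Fields.
- by apply/funext => i; apply/funext => j; rewrite rhs_eta_lin; ring.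
- by apply/funext => i; apply/funext => j; rewrite rhs_kap_lin; ring.
- by rewrite mulr0 addr0.
- by apply/funext => i; rewrite mulr0 addr0.
- by rewrite /rhs_phi /=; ring.
- exact: rhs_psi_lin.
Qed.

Lemma fields_of_UP_lin x k (U V : 'cV[CC R]_(dimP d)) :
  fields_of_UP ell x (k *: U + V) =
  flin k (fields_of_UP ell x U) (fields_of_UP ell x V).
Proof.
rewrite /fields_of_UP.
set F0 := Fields _ _ 0 _ _ _; set F1 := Fields _ _ 0 _ _ _.
set F2 := Fields _ _ 0 _ _ _.
have -> : F0 = flin k F1 F2.
  rewrite /flin /=; congr Fields.
  - apply/funext => i; apply/funext => j; rewrite !mxE.
    by case: (ell i == ell j); ring.
  - by apply/funext => i; apply/funext => j; rewrite !mxE; ring.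
  - by rewrite mulr0 addr0.
  - by apply/funext => i; rewrite mulr0 addr0.
  - by rewrite !mxE.
  - by rewrite !mxE.
rewrite curv_lin /flin /=; congr Fields; ring.
Qed.

(** The columns of AP are the images of the basis vectors under a linear map. *)
Lemma AP_mul x (U : 'cV[CC R]_(dimP d)) :
  AP ell lphi x *m U = UP_rate ell lphi x (fields_of_UP ell x U).
Proof.
pose L U := UP_rate ell lphi x (fields_of_UP ell x U).
have Llin k V V' : L (k *: V + V') = k *: L V + L V'.
  by rewrite /L fields_of_UP_lin UP_rate_lin.
have L0 : L 0 = 0.
  by have := Llin (-1) 0 0; rewrite !scaleN1r oppr0 addr0 addNr.
have Lsum (r : seq 'I_(dimP d)) :
    L (\sum_(c <- r) U c 0 *: delta_mx c 0) = \sum_(c <- r) U c 0 *: L (delta_mx c 0).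
  by elim: r => [|c r IH]; rewrite ?big_nil // !big_cons Llin IH.
have UE : U = \sum_c U c 0 *: delta_mx c 0.
  rewrite {1}[U]matrix_sum_delta; apply: eq_bigr => c _.
  by rewrite big_ord1.
apply/matrixP => r c; rewrite ord1 -/(L U) [in RHS]UE Lsum mxE summxE.
by apply: eq_bigr => s _; rewrite !mxE mulrC.
Qed.

(** The quotient and remainder of i * d + j by d recover (i, j), so the row
    search in [block] finds no other pair. *)
Lemma block_inord (i j : 'I_d) (b : bool) :
  block (inord (2 * (i * d + j) + b) : 'I_(dimP d)) = Some (i, j)
  /\ ((inord (2 * (i * d + j) + b) : 'I_(dimP d)) : nat) = (2 * (i * d + j) + b)%N.
Proof.
have lt : (i * d + j < d ^ 2)%N.
  rewrite -mulnn; apply: (@leq_trans (i * d + d)); first by rewrite ltn_add2l.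
  by rewrite -mulSnr leq_mul2r ltn_ord orbT.
have e : ((inord (2 * (i * d + j) + b) : 'I_(dimP d)) : nat) = (2 * (i * d + j) + b)%N.
  rewrite inordK //; apply: (@leq_trans (2 * (i * d + j).+1)).
    by rewrite mulnS addnC ltn_add2r; case: b.
  by do 2 apply: leqW; rewrite leq_mul2l.
split=> //; rewrite /block e.
have -> : ((2 * (i * d + j) + b)./2 = i * d + j)%N.
  by rewrite addnC mul2n half_bit_double.
case: pickP => [[i' j'] /= /eqP h|/(_ (i, j))]; last by rewrite /= eqxx.
have d0 : (0 < d)%N by apply: leq_ltn_trans (ltn_ord i).
have hi : i' = i :> nat.
  have := congr1 (fun n => n %/ d)%N h.
  by rewrite !divnMDl // !divn_small // !addn0.
have hj : j' = j :> nat by move: h; rewrite hi => /addnI.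
by congr (Some (_, _)); apply: val_inj.
Qed.

Lemma block_last (b : bool) :
  block (inord (2 * d ^ 2 + b) : 'I_(dimP d)) = None
  /\ ((inord (2 * d ^ 2 + b) : 'I_(dimP d)) : nat) = (2 * d ^ 2 + b)%N.
Proof.
have e : ((inord (2 * d ^ 2 + b) : 'I_(dimP d)) : nat) = (2 * d ^ 2 + b)%N.
  by rewrite inordK //; case: b; rewrite ?addn1 ?addn0.
split=> //; rewrite /block e.
have -> : ((2 * d ^ 2 + b)./2 = d ^ 2)%N by rewrite addnC mul2n half_bit_double.
case: pickP => [[i j] /= /eqP h|//].
have lt : (i * d + j < d ^ 2)%N.
  rewrite -mulnn; apply: (@leq_trans (i * d + d)); first by rewrite ltn_add2l.
  by rewrite -mulSnr leq_mul2r ltn_ord orbT.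
by rewrite h ltnn in lt.
Qed.

Lemma symb_ge0 x : 0 <= symb ell x.
Proof.
apply: sumr_ge0 => a _; rewrite /tp /xc -rmorphXn -rmorphM.
by rewrite -rC0 ler_rC mulr_ge0 ?powR_ge0 ?sqr_ge0.
Qed.

(** Here the elliptic equation returns the lapse: 1 + symb is nonzero, since
    symb is a sum of nonnegative terms. *)
Lemma fields_of_UPK x F : 0 < x.1 -> elliptic ell x F -> (forall i, chi F i = 0) ->
  fields_of_UP ell x (UP ell x F) = F.
Proof.
move=> x0 ellF chi0; rewrite /fields_of_UP.
have tpK a b : tp x (a - b) * tp x (b - a) = 1.
  rewrite /tp -rmorphM -powRD; last by rewrite (gt_eqF x0) implybT.
  by rewrite subrKA subrr powRr0 rmorph1.
have kapE i j : UP ell x F (inord (2 * (i * d + j)).+1) 0 = bar ell x (kap F) i j.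
  have [] := block_inord i j true; rewrite addn1 => b e.
  by rewrite mxE b e /= mul2n odd_double.
have UpsE i j : UP ell x F (inord (2 * (i * d + j))) 0 = Upsbar ell x F i j.
  have [] := block_inord i j false; rewrite addn0 => b e.
  by rewrite mxE b e /= mul2n odd_double.
have phiE : UP ell x F (inord (2 * d ^ 2)) 0 = phi F.
  have [] := block_last false; rewrite addn0 => b e.
  by rewrite mxE b e /= mul2n odd_double.
have psiE : UP ell x F (inord (2 * d ^ 2).+1) 0 = psi F.
  have [] := block_last true; rewrite addn1 => b e.
  by rewrite mxE b e /= mul2n odd_double.
set F0 := Fields _ _ 0 _ _ _.
have etaF : eta F0 = eta F.
  rewrite /=; apply/funext => i; apply/funext => j; rewrite kapE UpsE /Upsbar /bar.
  by case: (ell i == ell j); rewrite ?addrK mulrA tpK mul1r.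
have kapF : kap F0 = kap F.
  rewrite /=; apply/funext => i; apply/funext => j; rewrite kapE /bar.
  by rewrite mulrA tpK mul1r.
have curvF : curv ell x F0 = curv ell x F by rewrite /curv etaF.
have nz : 1 + symb ell x != 0.
  by rewrite gt_eqF // ltr_wpDr // symb_ge0.
rewrite etaF kapF curvF /= phiE psiE -ellF mulKf //.
have -> : (fun _ : 'I_d => 0) = chi F by apply/funext => i; rewrite chi0.
by case: F {ellF chi0 kapE UpsE phiE psiE F0 etaF kapF curvF}.
Qed.

Lemma UP_rate_AP x F : 0 < x.1 -> elliptic ell x F -> (forall i, chi F i = 0) ->
  UP_rate ell lphi x F = AP ell lphi x *m UP ell x F.
Proof. by move=> x0 eF cF; rewrite AP_mul fields_of_UPK. Qed.
End LinearSystem.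

(** * The differential equation of the transformed unknowns *)

(** The algebra behind the equation for V = Q U, with a = djap xi, z1 = 1 / z
    and s1 = 1 / t: P stands for the z-derivative of Q, A0 for AP, and the
    matrix applied to U at the end is the remainder. *)
Lemma remainder_identity (K : comPzRingType) n (P Q A0 B0 S : 'M[K]_n)
    (U : 'cV[K]_n) (a z1 s1 : K) : a * z1 = s1 ->
  (a *: P) *m U + Q *m (s1 *: (A0 *m U)) =
  s1 *: (B0 *m (Q *m U)) + a *: (S *m (Q *m U) +
    (P + Q *m (z1 *: A0) - (z1 *: B0 + S) *m Q) *m U).
Proof.
move=> <-; rewrite !(mulmxDl, mulNmx) !mulmxA.
have -> : Q *m (z1 *: A0) = z1 *: (Q *m A0) by rewrite scalemxAr.
rewrite -!scalemxAl -!scalemxAr !mulmxA !scalerDr scalerN scalerDr !scalerA.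
set a0 := a *: (P *m U); set a1 := _ *: (Q *m A0 *m U).
set a2 := _ *: (B0 *m Q *m U); set a3 := _ *: (S *m Q *m U).
by rewrite [RHS]addrA [RHS]addrC subrK.
Qed.

Section ODE.
Variables (R : realType) (d : nat) (ell : 'I_d -> R) (lphi : R).
Implicit Types (x : tpoint R d) (xi : 'rV[R]_d) (Z : set (tpoint R d)).

Lemma pderivable_deriv_within Z (f : tpoint R d -> CC R) xi s :
  pderivable Z f (s, xi) ->
  deriv_within [set t | Z (t, xi)] (fun t => f (t, xi)) s (pdt Z f (s, xi)).
Proof. by move=> h; apply: HasD; exact: h. Qed.

Lemma pderivable_deriv_within_mx Z n (f : tpoint R d -> 'M[CC R]_n) xi s i j :
  pderivable Z f (s, xi) ->
  deriv_within [set t | Z (t, xi)] (fun t => f (t, xi) i j) s (pdt Z f (s, xi) i j).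
Proof.
move=> h; apply: HasD.
have -> : (fun t => rC (t - s)^-1 * (f (t, xi) i j - f (s, xi) i j)) =
    (fun t => dquot f (s, xi) t i j).
  by apply/funext => t; rewrite /dquot !mxE.
by apply: cvg_mx_entry; exact: h.
Qed.

Lemma deriv_within_mulmx (A : set R) m n p (f : R -> 'M[CC R]_(m, n))
    (g : R -> 'M[CC R]_(n, p)) s (df : 'M[CC R]_(m, n)) (dg : 'M[CC R]_(n, p)) :
  (forall i j, deriv_within A (fun t => f t i j) s (df i j)) ->
  (forall i j, deriv_within A (fun t => g t i j) s (dg i j)) ->
  forall i j, deriv_within A (fun t => (f t *m g t) i j) s
    ((df *m g s + f s *m dg) i j).
Proof.
move=> hf hg i j.
have -> : (fun t => (f t *m g t) i j) = (fun t => \sum_k f t i k * g t k j).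
  by apply/funext => t; rewrite mxE.
rewrite !mxE -big_split; apply: deriv_within_sum => k _.
exact: deriv_withinM (hf i k) (hg k j).
Qed.

Lemma deriv_within_tp (A : set R) xi s e : 0 < s ->
  deriv_within A (fun t => tp (t, xi) e) s (rC s^-1 * (rC e * tp (s, xi) e)).
Proof.
move=> s0; have h := deriv_within_rC A (is_derive1_powR e s0).
move: h; congr deriv_within; rewrite /tp /= -!rmorphM; congr rC.
rewrite powRB; last by rewrite (gt_eqF s0) implybT.
by rewrite powRr1 ?ltW //; ring.
Qed.

(** The weight t ^ (ell i - ell j) contributes the term with the factor
    ell i - ell j, exactly as in the definition of [UP_rate]. *)
Lemma deriv_within_bar (A : set R) xi s (f : R -> 'I_d -> 'I_d -> CC R)
    (r : 'I_d -> 'I_d -> CC R) :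
  0 < s -> (forall i j, deriv_within A (fun t => f t i j) s (rC s^-1 * r i j)) ->
  forall i j, deriv_within A (fun t => bar ell (t, xi) (f t) i j) s
    (rC s^-1 * bar ell (s, xi)
       (fun i j => (lc ell i - lc ell j) * f s i j + r i j) i j).
Proof.
move=> s0 h i j; have := deriv_withinM (deriv_within_tp A xi (ell i - ell j) s0) (h i j).
by congr deriv_within; rewrite /bar /lc rmorphB; ring.
Qed.

Lemma deriv_within_UP (T : R) (u : tpoint R d -> fields R d) xi s : 0 < s <= T ->
  solution ell lphi T u ->
  forall r c, deriv_within [set t | 0 < t <= T]
    (fun t => UP ell (t, xi) (u (t, xi)) r c) s
    ((rC s^-1 *: UP_rate ell lphi (s, xi) (u (s, xi))) r c).
Proof.
move=> sT [[ceta ckap cphi cpsi] [ev _ _ _]] r c.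
have s0 : 0 < s by case/andP: sT.
have [eeta ekap ephi epsi] := ev (s, xi) sT.
have key (f : tpoint R d -> CC R) l : C1_in_time (slab T) f ->
    rC s * pdt (slab T) f (s, xi) = l ->
    deriv_within [set t | 0 < t <= T] (fun t => f (t, xi)) s (rC s^-1 * l).
  move=> [df _] <-; rewrite mulrA -rmorphM mulVf ?gt_eqF // rmorph1 mul1r.
  exact: pderivable_deriv_within (df (s, xi) sT).
have heta := deriv_within_bar xi s0 (fun i j => key _ _ (ceta i j) (eeta i j)).
have hkap := deriv_within_bar xi s0 (fun i j => key _ _ (ckap i j) (ekap i j)).
have hphi := key _ _ cphi ephi.
have hpsi := key _ _ cpsi epsi.
have -> : (fun t => UP ell (t, xi) (u (t, xi)) r c) = (fun t =>
   match block r with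
   | Some (i, j) => if odd r then bar ell (t, xi) (kap (u (t, xi))) i j
                    else Upsbar ell (t, xi) (u (t, xi)) i j
   | None => if odd r then psi (u (t, xi)) else phi (u (t, xi)) end).
  by apply/funext => t; rewrite mxE.
rewrite mxE [UP_rate _ _ _ _ _ _]mxE.
case: (block r) => [[i j]|]; last by case: (odd r).
case: (odd r); first exact: hkap.
rewrite /Upsbar; case: (ell i == ell j); first exact: heta.
have := deriv_withinD (heta i j)
  (deriv_withinM (deriv_within_cst [set t | 0 < t <= T]
     (2 * (lc ell j - lc ell i))^-1 s) (hkap i j)).
by congr deriv_within; rewrite mul0r add0r [_^-1 * (_ * _)]mulrCA -mulrDr.
Qed.

Section Normalized.
Variables (T rho : R) (D N Rm : nat -> tpoint R d -> 'M[CC R]_(dimP d)) (m : nat).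
Local Notation Z := (zoneP ell T rho).
Hypothesis dN : forall k x, (1 <= k <= m)%N -> Z x -> pderivable Z (N k) x.
Hypothesis RmE : forall x, Z x -> Rm m x =
            \sum_(1 <= k < m.+1) pdz ell Z (N k) x
            + QP N m x *m (rC (zvar ell x)^-1 *: BP ell + RP ell lphi x)
            - (rC (zvar ell x)^-1 *: BP ell + \sum_(1 <= k < m.+1) D k x)
              *m QP N m x.

Variables (u : tpoint R d -> fields R d) (xi : 'rV[R]_d) (A : set R).
Hypothesis solu : solution ell lphi T u.
Hypothesis AZ : forall t, A t -> Z (t, xi).
Hypothesis chi0 : forall t, A t -> forall i, chi (u (t, xi)) i = 0.
Hypothesis djap_gt0 : 0 < djap ell xi.

Definition Dsum x : 'M[CC R]_(dimP d) := \sum_(1 <= k < m.+1) D k x.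
(** U, V = Q U and, below, W = E V along the time slice at the frequency xi. *)
Definition Uv t := UP ell (t, xi) (u (t, xi)).
Definition Vv t := QP N m (t, xi) *m Uv t.

Let A_gt0 t : A t -> 0 < t <= T. Proof. by move=> /AZ []. Qed.

Lemma deriv_within_QP s : A s -> forall i j,
  deriv_within A (fun t => QP N m (t, xi) i j) s
   ((\sum_(1 <= k < m.+1) pdt Z (N k) (s, xi)) i j).
Proof.
move=> As i j.
have -> : (fun t => QP N m (t, xi) i j) =
    (fun t => (1%:M : 'M[CC R]_(dimP d)) i j +
       \sum_(k <- index_iota 1 m.+1 | (1 <= k <= m)%N) N k (t, xi) i j).
  apply/funext => t; rewrite /QP mxE summxE; congr (_ + _).
  rewrite [in LHS]big_seq_cond; apply: eq_bigl => k.
  by rewrite andbT mem_index_iota ltnS.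
have -> : (\sum_(1 <= k < m.+1) pdt Z (N k) (s, xi)) i j =
    0 + \sum_(k <- index_iota 1 m.+1 | (1 <= k <= m)%N) pdt Z (N k) (s, xi) i j.
  rewrite summxE add0r big_seq_cond; apply: eq_bigl => k.
  by rewrite andbT mem_index_iota ltnS.
apply: deriv_withinD; first exact: deriv_within_cst.
apply: deriv_within_sum => k km; apply: (@deriv_within_sub _ A [set t | Z (t, xi)]).
  by move=> t; exact: AZ.
by apply: pderivable_deriv_within_mx; apply: dN => //; exact: AZ.
Qed.

Lemma deriv_within_Vv s : A s -> forall i j,
  deriv_within A (fun t => Vv t i j) s
   ((rC s^-1 *: (BP ell *m Vv s) +
     rC (djap ell xi) *: (Dsum (s, xi) *m Vv s + Rm m (s, xi) *m Uv s)) i j).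
Proof.
move=> As; have s0 : 0 < s by case/andP: (A_gt0 As).
have hU : forall i j, deriv_within A (fun t => Uv t i j) s
    ((rC s^-1 *: (AP ell lphi (s, xi) *m Uv s)) i j).
  move=> i j; rewrite -UP_rate_AP //; last 2 first.
  - by case: solu => _ [_ + _ _]; apply; exact: A_gt0.
  - exact: chi0.
  apply: (@deriv_within_sub _ A [set t | 0 < t <= T]); first by move=> t; exact: A_gt0.
  exact: (deriv_within_UP xi (A_gt0 As) solu).
have h := deriv_within_mulmx (deriv_within_QP As) hU.
move=> i j; move: (h i j); congr (deriv_within A _ s (fun_of_matrix _ i j)).
have zE : zvar ell (s, xi) = djap ell xi * s by [].
have d0 : djap ell xi != 0 by rewrite gt_eqF.
have E1 : rC (djap ell xi) * rC (zvar ell (s, xi))^-1 = rC s^-1.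
  by rewrite -rmorphM zE invfM mulrA mulfV // mul1r.
rewrite (RmE (AZ As)) /Vv /Dsum.
rewrite /RP scalerBr [rC (zvar _ _)^-1 *: BP ell + (_ - _)]addrC subrK.
set S := \sum_(1 <= k < m.+1) D k (s, xi); set Q := QP N m _.
have -> : \sum_(1 <= k < m.+1) pdt Z (N k) (s, xi) =
    rC (djap ell xi) *: \sum_(1 <= k < m.+1) pdz ell Z (N k) (s, xi).
  rewrite scaler_sumr; apply: eq_bigr => k _.
  by rewrite /pdz scalerA -rmorphM mulfV // rmorph1 scale1r.
exact: remainder_identity E1.
Qed.

Definition Wv t := EP ell (t, xi) *m Vv t.
Definition Einv t := exp_jordan (Bdiag ell) (Bnil ell) (ln (zvar ell (t, xi))).

Lemma Einv_Wv t : Einv t *m Wv t = Vv t.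
Proof.
rewrite /Wv EP_exp_jordan mulmxA exp_jordanD ?subrr ?exp_jordan0 ?mul1mx //.
- exact: Bdiag_Bnil.
- exact: Bnil_Bdiag.
- exact: Bnil_Bnil.
Qed.

Definition dWv s := rC (djap ell xi) *:
  (EP ell (s, xi) *m Dsum (s, xi) *m Vv s
   + EP ell (s, xi) *m Rm m (s, xi) *m Uv s).

(** E' = - E B / t cancels the singular term B V / t of V'. *)
Lemma deriv_within_Wv s : A s -> forall i j,
  deriv_within A (fun t => Wv t i j) s (dWv s i j).
Proof.
move=> As; have s0 : 0 < s by case/andP: (A_gt0 As).
have dln : is_derive s 1 (fun t => - ln (zvar ell (t, xi))) (- s^-1).
  have h1 : is_derive s 1 (fun t => djap ell xi * t) (djap ell xi * 1).
    exact: is_deriveZ.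
  have h2 := is_derive1_ln (mulr_gt0 djap_gt0 s0).
  have h3 := @is_derive1_comp _ (@ln R) (fun t => djap ell xi * t) s _ _ h2 h1.
  have h4 := is_deriveN h3.
  apply: (is_derive_eq h4); rewrite mulr1 invfM mulrAC mulVf ?mul1r //.
  by rewrite gt_eqF.
have hE : forall i j, deriv_within A (fun t => EP ell (t, xi) i j) s
    ((- rC s^-1 *: (EP ell (s, xi) *m BP ell)) i j).
  move=> i j; have := @deriv_within_exp_jordan R _ (Bdiag ell) (Bnil ell) (Bdiag_Bnil ell)
    (Bnil_Bdiag ell) (Bnil_Bnil ell) A _ _ _ dln i j.
  have -> : (fun t => EP ell (t, xi) i j) =
     (fun t => exp_jordan (Bdiag ell) (Bnil ell) (- ln (zvar ell (t, xi))) i j).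
    by apply/funext => t; rewrite EP_exp_jordan.
  by rewrite EP_exp_jordan BP_split rmorphN.
move=> i j; have := deriv_within_mulmx hE (deriv_within_Vv As) i j.
congr (deriv_within A _ s (fun_of_matrix _ i j)).
rewrite scaleNr mulNmx -scalemxAl mulmxDr -!scalemxAr addrA !mulmxA addNr add0r.
by rewrite /dWv mulmxDr !mulmxA.
Qed.

End Normalized.

End ODE.

(** * Growth at z = 0, up to an arbitrarily small power *)

Section LogPower.
Variable R : realType.
Implicit Types z q : R.

(** From 1 + x <= exp x at x = b |log z|, with b = e / (p + 1) so that the p-th
    power costs less than z ^ (- e). *)
Lemma log_pow_le (p : nat) (e : R) : 0 < e -> exists C : R, 0 <= C /\
  forall z, 0 < z < 1 -> (1 + `|ln z|) ^+ p <= C * z `^ (- e).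
Proof.
move=> e0; pose b := e / p.+1%:R; have b0 : 0 < b by rewrite divr_gt0.
exists ((1 + b^-1) ^+ p); split=> [|z /andP[z0 z1]].
  by rewrite exprn_ge0 // addr_ge0 // invr_ge0 ltW.
have h1 : 1 + `|ln z| <= (1 + b^-1) * z `^ (- b).
  have lz : ln z <= 0 by rewrite ln_le0 // ltW.
  rewrite ler0_norm // /powR (gt_eqF z0).
  have h : 1 + (- b * ln z) <= expR (- b * ln z) by exact: expR_ge1Dx.
  have h0 : 1 <= expR (- b * ln z).
    by rewrite -expR0 ler_expR mulNr -mulrN mulr_ge0 ?oppr_ge0 // ltW.
  rewrite mulrDl mul1r lerD // -(ler_pM2l b0) mulrA mulfV ?gt_eqF // mul1r.
  by rewrite mulrN -mulNr; apply: le_trans h; rewrite lerDr.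
apply: (@le_trans _ _ (((1 + b^-1) * z `^ (- b)) ^+ p)).
  by rewrite lerXn2r // nnegrE ?mulr_ge0 ?powR_ge0 // addr_ge0 // invr_ge0 ltW.
rewrite exprMn ler_wpM2l //; first by rewrite exprn_ge0 // addr_ge0 // invr_ge0 ltW.
rewrite -powR_mulrn ?powR_ge0 // -powRrM; apply: ger_powR; first by rewrite z0 ltW.
rewrite mulNr lerN2 /b mulrAC ler_pdivrMr // ler_wpM2l ?ler_nat //; exact: ltW.
Qed.
End LogPower.

Section SmallO.
Variables (R : realType) (X : Type) (z : X -> R) (Z : set X).
Hypothesis z01 : forall x, Z x -> 0 < z x < 1.

(** Order q in z, up to an arbitrarily small loss e in the exponent. The loss
    absorbs powers of the logarithm, so that orders simply add under products
    and a factor log z has order 0. *)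
Definition zO m n (f : X -> 'M[CC R]_(m, n)) (q : R) :=
  forall e : R, 0 < e -> exists C : R, 0 <= C /\
  forall x, Z x -> forall i j, `|f x i j| <= rC (C * z x `^ (q - e)).

Let zpow x p q : Z x -> q <= p -> z x `^ p <= z x `^ q.
Proof. by move=> /z01/andP[z0 z1] qp; apply: ger_powR => //; rewrite z0 ltW. Qed.

Lemma zO_weak m n (f : X -> 'M[CC R]_(m, n)) p q : q <= p -> zO f p -> zO f q.
Proof.
move=> qp hf e e0; have [C [C0 h]] := hf e e0; exists C; split=> // x Zx i j.
apply: le_trans (h x Zx i j) _; rewrite ler_rC ler_wpM2l // zpow //.
by rewrite lerB.
Qed.

Lemma zOD m n (f g : X -> 'M[CC R]_(m, n)) q :
  zO f q -> zO g q -> zO (fun x => f x + g x) q.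
Proof.
move=> hf hg e e0; have [C [C0 h]] := hf e e0; have [C' [C0' h']] := hg e e0.
exists (C + C'); split=> [|x Zx i j]; first exact: addr_ge0.
rewrite mxE mulrDl rmorphD; apply: le_trans (ler_normD _ _) _.
by apply: lerD; [exact: h|exact: h'].
Qed.

Lemma zON m n (f : X -> 'M[CC R]_(m, n)) q : zO f q -> zO (fun x => - f x) q.
Proof.
move=> hf e e0; have [C [C0 h]] := hf e e0; exists C; split=> // x Zx i j.
by rewrite mxE normrN; exact: h.
Qed.

Lemma zO0 m n q : zO (fun=> 0 : 'M[CC R]_(m, n)) q.
Proof.
by move=> e e0; exists 0; split=> // x Zx i j; rewrite mxE normr0 mul0r rC0.
Qed.

Lemma zO_sum m n (I : Type) (r : seq I) (P : pred I)
    (f : I -> X -> 'M[CC R]_(m, n)) q :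
  (forall i, P i -> zO (f i) q) -> zO (fun x => \sum_(i <- r | P i) f i x) q.
Proof.
move=> H; elim: r => [|i r IH].
  have -> : (fun x => \sum_(i <- [::] | P i) f i x) = fun=> 0.
    by apply/funext => x; rewrite big_nil.
  exact: zO0.
have -> : (fun x => \sum_(i <- i :: r | P i) f i x) =
    fun x => (if P i then f i x else 0) + \sum_(i <- r | P i) f i x.
  by apply/funext => x; rewrite big_cons; case: ifP; rewrite ?add0r.
apply: zOD IH.
by case Pi : (P i); [exact: H|exact: zO0].
Qed.

Lemma zOM m n p (f : X -> 'M[CC R]_(m, n)) (g : X -> 'M[CC R]_(n, p)) q r :
  zO f q -> zO g r -> zO (fun x => f x *m g x) (q + r).
Proof.
move=> hf hg e e0; have e20 : 0 < e / 2 by rewrite divr_gt0.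
have [C [C0 h]] := hf _ e20; have [C' [C0' h']] := hg _ e20.
exists (n%:R * (C * C')); split=> [|x Zx i j]; first by rewrite !mulr_ge0.
have zE : z x `^ (q + r - e) = z x `^ (q - e / 2) * z x `^ (r - e / 2).
  have /andP[z0 _] := z01 Zx.
  rewrite -powRD; last by rewrite (gt_eqF z0) implybT.
  by congr (_ `^ _); rewrite addrACA -opprD -splitr.
rewrite mxE; apply: le_trans (ler_norm_sum _ _ _) _.
apply: (@le_trans _ _ (\sum_(k < n)
    rC ((C * z x `^ (q - e / 2)) * (C' * z x `^ (r - e / 2))))).
  apply: ler_sum => k _; rewrite normrM rmorphM.
  by apply: ler_pM; [exact: normr_ge0|exact: normr_ge0|exact: h|exact: h'].
rewrite sumr_const card_ord -rmorphMn ler_rC zE -mulr_natl le_eqVlt; apply/orP; left.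
by apply/eqP; ring.
Qed.

Lemma zO_log m n (f : X -> 'M[CC R]_(m, n)) q (C : R) (p : nat) :
  (forall x, Z x -> forall i j,
    `|f x i j| <= rC (C * z x `^ q * (1 + `|ln (z x)|) ^+ p)) ->
  zO f q.
Proof.
move=> hf e e0; have [K [K0 hK]] := log_pow_le p e0.
exists (`|C| * K); split=> [|x Zx i j]; first exact: mulr_ge0.
apply: le_trans (hf x Zx i j) _; rewrite ler_rC.
have /andP[z0 z1] := z01 Zx.
rewrite powRD; last by rewrite (gt_eqF z0) implybT.
rewrite [leRHS](_ : _ = `|C| * z x `^ q * (K * z x `^ (- e))); last by ring.
have l0 : 0 <= (1 + `|ln (z x)|) ^+ p by rewrite exprn_ge0 // addr_ge0.
apply: (@le_trans _ _ (`|C| * z x `^ q * (1 + `|ln (z x)|) ^+ p)).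
  by rewrite !ler_wpM2r ?powR_ge0 // ler_norm.
by rewrite ler_wpM2l ?mulr_ge0 ?powR_ge0 //; apply: hK; rewrite z0 z1.
Qed.

Lemma zO_lnZ m n (f : X -> 'M[CC R]_(m, n)) :
  (forall x, Z x -> forall i j, `|f x i j| <= 1) ->
  zO (fun x => rC (ln (z x)) *: f x) 0.
Proof.
move=> hf; apply: (@zO_log _ _ _ _ 1 1) => x Zx i j.
rewrite powRr0 expr1 !mul1r mxE normrM norm_rC.
apply: (@le_trans _ _ (rC `|ln (z x)| * 1)).
  by apply: ler_wpM2l (hf x Zx i j); rewrite -rC0 ler_rC.
by rewrite mulr1 ler_rC lerDr.
Qed.

Lemma zO_exp_jordan n (lam : 'I_n.+1 -> R) (Nil : 'M[CC R]_n.+1) (M : R) (y : X -> R) :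
  (forall i, `|lam i| <= M) -> (forall i j, `|Nil i j| <= 1) ->
  (forall x, Z x -> `|y x| = `|ln (z x)|) ->
  zO (fun x => exp_jordan lam Nil (y x)) (- M).
Proof.
move=> lM N1 yln; apply: (@zO_log _ _ _ _ 1 1) => x Zx i j.
have /andP[z0 z1] := z01 Zx.
have M0 : 0 <= M by apply: le_trans (lM i).
have ln0 : ln (z x) <= 0 by rewrite ln_le0 // ltW.
have pE : z x `^ (- M) = expR (M * `|ln (z x)|).
  by rewrite /powR (gt_eqF z0) ler0_norm // mulNr mulrN.
have p1 : 1 <= z x `^ (- M) by rewrite pE -expR0 ler_expR mulr_ge0.
rewrite /exp_jordan mxE rdiag_mxE mxE expr1 mul1r mulrDr mulr1 rmorphD.
apply: le_trans (ler_normD _ _) _; apply: lerD.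
  rewrite normrMn norm_rC; apply: (@le_trans _ _ (rC `|expR (y x * lam i)|)).
    by case: eqP => _; rewrite ?mulr1n // mulr0n -rC0 ler_rC.
  rewrite ler_rC ger0_norm ?expR_ge0 // pE ler_expR.
  apply: le_trans (ler_norm _) _; rewrite normrM yln // mulrC.
  by rewrite ler_wpM2r.
rewrite normrM norm_rC yln //; apply: (@le_trans _ _ (rC `|ln (z x)| * 1)).
  by apply: ler_wpM2l => //; rewrite -rC0 ler_rC.
by rewrite mulr1 ler_rC ler_peMl.
Qed.
End SmallO.

Section VectorBounds.
Variable R : realType.

Lemma mulmx_entry_le m n p (A : 'M[CC R]_(m, n)) (B : 'M[CC R]_(n, p)) (a b : R) :
  (forall i j, `|A i j| <= rC a) -> (forall j k, `|B j k| <= rC b) ->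
  forall i k, `|(A *m B) i k| <= rC (n%:R * (a * b)).
Proof.
move=> hA hB i k; rewrite mxE; apply: le_trans (ler_norm_sum _ _ _) _.
apply: (@le_trans _ _ (\sum_(j < n) rC (a * b))).
  by apply: ler_sum => j _; rewrite normrM rmorphM; apply: ler_pM.
by rewrite sumr_const card_ord -rmorphMn mulr_natl.
Qed.

Lemma mx_norm_rC m n (A : 'M[CC R]_(m, n)) : exists2 a : R, 0 <= a & `|A| = rC a.
Proof.
have := normr_ge0 A; rewrite le_eqVlt => /orP[/eqP <-|/gt0_rC[a a0 ->]].
  by exists 0; rewrite ?rC0.
by exists a => //; exact: ltW.
Qed.

Lemma entry_le_norm m n (A : 'M[CC R]_(m, n)) i j : `|A i j| <= `|A|.
Proof. by move: i j; apply/mx_norm_leP. Qed.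

(** U = (U + P U) - P U, and the last term is at most half the norm of U. *)
Lemma near_identity_le n (P : 'M[CC R]_n) (U : 'cV[CC R]_n) (a v : R) :
  0 <= v -> n%:R * a <= 2^-1 -> (forall i j, `|P i j| <= rC a) ->
  (forall i j, `|(U + P *m U) i j| <= rC v) -> forall i j, `|U i j| <= rC (2 * v).
Proof.
move=> v0 na hP hV.
have [m m0 mE] := mx_norm_rC U.
have hU i j : `|U i j| <= rC m by rewrite -mE; exact: entry_le_norm.
suff : m <= 2 * v by move=> mv i j; apply: le_trans (hU i j) _; rewrite ler_rC.
have : `|U| <= rC (v + 2^-1 * m).
  apply/mx_norm_leP; first by rewrite -rC0 ler_rC addr_ge0 // mulr_ge0 // invr_ge0.
  move=> i j.
  have -> : U i j = (U + P *m U) i j - (P *m U) i j by rewrite [in RHS]mxE addrK.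
  rewrite rmorphD; apply: le_trans (ler_normB _ _) _; apply: lerD (hV i j) _.
  apply: le_trans (mulmx_entry_le hP hU i j) _.
  by rewrite ler_rC mulrA ler_wpM2r.
by rewrite mE ler_rC; lra.
Qed.
End VectorBounds.

(** * Size of the coefficients in the zone *)

Section Weights.
Variables (R : realType) (d : nat) (ell : 'I_d -> R).

Lemma ellmin_gtN1 : (0 < d)%N -> (forall i, -1 < ell i) -> -1 < ellmin ell.
Proof.
case: d ell => // d' l _ hl.
have [//|i _ hi] := @arg_minP _ _ _ (ord0 : 'I_d'.+1) predT l.
apply: lt_le_trans (hl i) _; apply: lb_le_inf; first by exists (l ord0); exists ord0.
by move=> _ [j _ <-]; exact: (hi j isT).
Qed.

Lemma djap_ge1 xi : 1 <= djap ell xi.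
Proof. exact: bigmax_ge_id. Qed.
End Weights.

Section Estimates.
Variables (R : realType) (d : nat) (T : R) (ell : 'I_d -> R) (rho : R).
Variables (D N Rm : nat -> tpoint R d -> 'M[CC R]_(dimP d)).
Local Notation Z := (zoneP ell T rho).
Local Notation z := (zvar ell).
Local Notation al := (aP ell + 1).
Hypothesis rho_lt1 : rho < 1.
Hypothesis al_gt0 : 0 < al.

Lemma zone_z01 x : Z x -> 0 < z x < 1.
Proof.
move=> [/andP[t0 _] zr]; rewrite (le_lt_trans zr rho_lt1) andbT mulr_gt0 //.
exact: lt_le_trans ltr01 (djap_ge1 ell _).
Qed.

Lemma Sstar_zO (f : tpoint R d -> 'M[CC R]_(dimP d)) q : Sstar ell Z q f -> zO z Z f q.
Proof.
move=> [_ _ [p hp]]; have [C hC] := hp 0%N.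
apply: (@zO_log _ _ _ _ zone_z01 _ _ _ _ C p) => x Zx i j.
exact: le_trans (entry_le_norm _ i j) (hC x Zx).
Qed.

Lemma zO_bigsum (f : nat -> tpoint R d -> 'M[CC R]_(dimP d)) m q :
  (forall k, (1 <= k)%N -> zO z Z (f k) q) ->
  zO z Z (fun x => \sum_(1 <= k < m.+1) f k x) q.
Proof.
move=> H.
have -> : (fun x => \sum_(1 <= k < m.+1) f k x) =
    (fun x => \sum_(k <- index_iota 1 m.+1 | (1 <= k <= m)%N) f k x).
  apply/funext => x; rewrite big_seq_cond; apply: eq_bigl => k.
  by rewrite andbT mem_index_iota ltnS.
by apply: zO_sum => k /andP[k1 _]; exact: H.
Qed.

Let expM : R := \sum_r `|Bdiag ell r|.

Lemma zO_EP : zO z Z (EP ell) (- expM).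
Proof.
have -> : EP ell = (fun x => exp_jordan (Bdiag ell) (Bnil ell) (- ln (z x))).
  by apply/funext => x; rewrite EP_exp_jordan.
apply: (zO_exp_jordan zone_z01); [|exact: normr_Bnil|by move=> x _; rewrite normrN].
by move=> r; rewrite /expM (bigD1 r) //= lerDl sumr_ge0.
Qed.

Lemma zO_Einv : zO z Z (fun x => exp_jordan (Bdiag ell) (Bnil ell) (ln (z x))) (- expM).
Proof.
apply: (zO_exp_jordan zone_z01); [|exact: normr_Bnil|by []].
by move=> r; rewrite /expM (bigD1 r) //= lerDl sumr_ge0.
Qed.

(** By [exp_jordan_conj_diag], conjugation of a diagonal matrix only adds terms
    in which (log z) Nil stands on the left or right of it. *)
Lemma zO_conj (S : tpoint R d -> 'M[CC R]_(dimP d)) q :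
  (forall x, Z x -> is_diag_mx (S x)) -> zO z Z S q ->
  zO z Z (fun x => EP ell x *m S x *m exp_jordan (Bdiag ell) (Bnil ell) (ln (z x))) q.
Proof.
move=> Sd hS; pose LN x : 'M[CC R]_(dimP d) := rC (ln (z x)) *: Bnil ell.
have hLN : zO z Z LN 0 by apply: (zO_lnZ zone_z01) => x _; exact: normr_Bnil.
have h1 := zOM zone_z01 hLN hS; rewrite add0r in h1.
have h2 := zOM zone_z01 hS hLN; rewrite addr0 in h2.
have h3 := zOM zone_z01 h1 hLN; rewrite addr0 in h3.
have h := zOD (zOD hS (zON (zOD h1 (zON h2)))) (zON h3).
move=> e e0; have [C [C0 hC]] := h e e0; exists C; split=> // x Zx i j.
have := hC x Zx i j; congr (`|fun_of_matrix _ i j| <= _).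
have := exp_jordan_conj_diag (Bdiag_Bnil ell) (Bnil_Bdiag ell) (- ln (z x)) (Sd x Zx).
rewrite opprK EP_exp_jordan => ->.
rewrite rmorphN scaleNr sqrrN expr2 /LN.
by rewrite -!scalemxAl -!scalemxAr scalerA rmorphM scalerBr.
Qed.

Lemma Dsum_is_diag m x : (forall k, (1 <= k)%N -> is_diag_mx (D k x)) ->
  is_diag_mx (Dsum D m x).
Proof.
move=> h; apply/is_diag_mxP => i j ij; rewrite /Dsum summxE big_seq_cond big1 // => k.
rewrite andbT mem_index_iota => /andP[k1 _].
by move/is_diag_mxP: (h k k1); apply.
Qed.
End Estimates.

(** * The main estimate *)

Theorem proposition4p5 (R : realType) (d : nat) (T : R) (ell : 'I_d -> R)
    (lphi : R) (rho : R)
    (D N Rm : nat -> tpoint R d -> 'M[CC R]_(dimP d)) :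
  (0 < d)%N -> 0 < T -> (forall i, -1 < ell i) -> 0 < rho < 1 ->
  (forall m : nat, (1 <= m)%N ->
    [/\ Sstar ell (zoneP ell T rho) (m%:R * (aP ell + 1) - 1) (D m),
        Sstar ell (zoneP ell T rho) (m%:R * (aP ell + 1)) (N m),
        Sstar ell (zoneP ell T rho) (m%:R * (aP ell + 1) + aP ell) (Rm m),
        forall x, zoneP ell T rho x -> is_diag_mx (D m x) &
        forall x, zoneP ell T rho x ->
          Rm m x =
            \sum_(1 <= k < m.+1) pdz ell (zoneP ell T rho) (N k) x
            + QP N m x *m (rC (zvar ell x)^-1 *: BP ell + RP ell lphi x)
            - (rC (zvar ell x)^-1 *: BP ell + \sum_(1 <= k < m.+1) D k x)
              *m QP N m x]) ->
  exists m0 : nat, forall mP : nat, (m0 <= mP)%N ->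
  exists rho1 : R, 0 < rho1 <= rho /\
  forall rho0 : R, 0 < rho0 <= rho1 ->
  exists C : R, 0 < C /\
  forall u : tpoint R d -> fields R d,
    solution ell lphi T u ->
    (forall x, zoneP ell T rho0 x -> forall i, chi (u x) i = 0) ->
    (forall xi : 'rV[R]_d,
       cvg ((fun tau : R => UPz ell N mP u (tau, xi)) @ 0^'+)) /\
    (forall (xi : 'rV[R]_d) (t0 t1 : R),
       0 <= t0 <= T -> 0 <= t1 <= T ->
       djap ell xi * t0 <= rho0 -> djap ell xi * t1 <= rho0 ->
       `|UPz_ext ell N mP u (t1, xi)|
       <= rC C * `|UPz_ext ell N mP u (t0, xi)|).
Proof.
move=> d0 T0 ell1 /andP[rho_gt0 rho_lt1] H.
set al := aP ell + 1.
have al0 : 0 < al.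
  by have := ellmin_gtN1 d0 ell1; rewrite /al /aP; lra.
set M : R := \sum_r `|Bdiag ell r|.
have M0 : 0 <= M by apply: sumr_ge0.
(* This makes m * al at least 2 M. *)
pose m0 := (Num.bound (2 * M / al)).+1.
exists m0 => m m0m.
have m1 : (1 <= m)%N by exact: leq_trans m0m.
have mal : 2 * M <= m%:R * al.
  rewrite -ler_pdivrMr //; apply: ltW; apply: (lt_le_trans (archi_boundP _)).
    by rewrite divr_ge0 ?mulr_ge0 // ltW.
  by rewrite ler_nat; exact: ltnW.
have z01 := @zone_z01 R d T ell rho rho_lt1.
have kal k : (1 <= k)%N -> al <= k%:R * al.
  by move=> k1; apply: ler_peMl; [exact: ltW|rewrite ler1n].
have hP : zO (zvar ell) (zoneP ell T rho) (fun x => \sum_(1 <= k < m.+1) N k x) al.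
  apply: zO_bigsum => k k1; apply: (zO_weak z01 (kal k k1)).
  by apply: (Sstar_zO rho_lt1); case: (H k k1).
have hS : zO (zvar ell) (zoneP ell T rho) (Dsum D m) (al - 1).
  apply: zO_bigsum => k k1.
  apply: (zO_weak z01 (_ : _ <= k%:R * al - 1)); first by rewrite lerB // kal.
  by apply: (Sstar_zO rho_lt1); case: (H k k1).
have Sdiag x : zoneP ell T rho x -> is_diag_mx (Dsum D m x).
  by move=> Zx; apply: Dsum_is_diag => k k1; case: (H k k1) => _ _ _ + _; apply.
have h1 := zO_conj rho_lt1 Sdiag hS.
have hRm : zO (zvar ell) (zoneP ell T rho) (Rm m) (m%:R * al + aP ell).
  by apply: (Sstar_zO rho_lt1); case: (H m m1).
have h2 := zOM z01 (zO_EP T ell rho_lt1) hRm.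
have h3 := zO_Einv T ell rho_lt1.
have al2 : 0 < al / 2 by rewrite divr_gt0.
have al4 : 0 < al / 4 by rewrite divr_gt0.
(* The losses al / 2 and al / 4 are chosen so that both parts of W' end up
   bounded by z ^ (al / 2 - 1). *)
have [CP [CP0 bP]] := hP _ al2.
have [C1 [C10 b1]] := h1 _ al2.
have [C2 [C20 b2]] := h2 _ al4.
have [C3 [C30 b3]] := h3 _ al4.
set n : R := (dimP d)%:R.
have n0 : 0 <= n by exact: ler0n.
(* If z ^ (al / 2) <= q0, then n CP z ^ (al / 2) <= 1 / 2. *)
set q0 : R := (2 * (n * CP + 1))^-1.
have q00 : 0 < q0 by rewrite invr_gt0 mulr_gt0 // ltr_wpDl // mulr_ge0.
exists (Num.min rho (q0 `^ (2 / al))); split.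
  by rewrite lt_min rho_gt0 powR_gt0 //= ge_min lexx.
move=> rho0 /andP[rho00]; rewrite le_min => /andP[rho0rho rho0q].
set be := al / 2; have be0 : 0 < be by rewrite divr_gt0.
(* K is read off from the bound on W' obtained below. *)
set K : R := n * C1 + 2 * n * n * C2 * C3.
have K0 : 0 <= K by rewrite /K addr_ge0 // !mulr_ge0.
set MG := K / be.
exists (Num.sqrt (expR (4 * n * MG) * n)); split.
  by rewrite sqrtr_gt0 mulr_gt0 ?expR_gt0 // ltr0n.
move=> u solu chi0.
have main xi : exists b : R, [/\ 0 < b,
    forall t, 0 <= t <= T -> djap ell xi * t <= rho0 -> 0 <= t <= b,
    cvg ((fun tau : R => UPz ell N m u (tau, xi)) @ 0^'+) &
    forall s t, 0 <= s <= b -> 0 <= t <= b ->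
      energy (UPz_ext ell N m u (s, xi)) <=
      expR (4 * n * MG) * energy (UPz_ext ell N m u (t, xi))].
  have dj0 : 0 < djap ell xi by exact: lt_le_trans ltr01 (djap_ge1 ell xi).
  (* b is the end of the time slice of the smaller zone. *)
  pose b := Num.min T (rho0 / djap ell xi).
  have b0 : 0 < b by rewrite lt_min T0 divr_gt0.
  pose A := [set t : R | 0 < t <= b].
  have AZ0 t : A t -> zoneP ell T rho0 (t, xi).
    rewrite /A /= le_min => /and3P[t0 tT tr]; split; first by rewrite t0 tT.
    by rewrite /zvar /= mulrC -ler_pdivlMr.
  have AZ t : A t -> zoneP ell T rho (t, xi).
    by move=> /AZ0 [h1' h2']; split=> //; exact: le_trans rho0rho.
  have dN k x : (1 <= k <= m)%N -> zoneP ell T rho x ->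
      pderivable (zoneP ell T rho) (N k) x.
    move=> /andP[k1 _] Zx; case: (H k k1) => _ [_ sm _] _ _ _.
    exact: (sm 0%N x Zx).
  have [_ _ _ _ RmE] := H m m1.
  have hW := deriv_within_Wv dN RmE solu AZ (fun t At => chi0 _ (AZ0 t At)) dj0.
  pose W := Wv ell N m u xi.
  have WE : (fun tau : R => UPz ell N m u (tau, xi)) = W.
    by apply/funext => t; rewrite /W /Wv /Vv /Uv mulmxA.
  pose G s := K / be * (djap ell xi * s) `^ be.
  pose g s := K * djap ell xi * (djap ell xi * s) `^ (be - 1).
  have G_g s : 0 < s <= b -> is_derive s 1 G (g s).
    move=> /andP[s0 _].
    have e1 : is_derive s 1 (fun t => djap ell xi * t) (djap ell xi * 1).
      exact: is_deriveZ.
    have e2 := is_derive1_powR be (mulr_gt0 dj0 s0).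
    have e3 := @is_derive1_comp _ (fun t => t `^ be) (fun t => djap ell xi * t) s _ _ e2 e1.
    have e4 := is_deriveZ (K / be) e3.
    apply: (is_derive_eq e4); rewrite /g /GRing.scale /=; field.
    by rewrite gt_eqF.
  have g_ge0 s : 0 < s <= b -> 0 <= g s.
    by move=> _; rewrite !mulr_ge0 ?powR_ge0 // ltW.
  have G_bd s : 0 < s <= b -> 0 <= G s <= MG.
    move=> sb; have /andP[z0 z1] := z01 _ (AZ s sb); rewrite /zvar /= in z0 z1.
    have KB : 0 <= K / be by rewrite divr_ge0 // ltW.
    rewrite mulr_ge0 ?powR_ge0 //= ler_piMr //.
    have := @ger_powR _ (djap ell xi * s) _ 0 be (ltW be0).
    by rewrite powRr0; apply; rewrite z0 ltW.
  have dW_le s c : 0 < s <= b -> (forall j, `|W s j 0| <= rC c) ->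
      forall i, `|dWv ell D N Rm m u xi s i 0| <= rC (g s * c).
    move=> sb Wc i; have Zs := AZ s sb; set x := (s, xi).
    have /andP[z0 z1] := z01 _ Zs; set z := zvar ell (s, xi) in z0 z1.
    have Wc' j k : `|W s j k| <= rC c by rewrite ord1.
    have c0 : 0 <= c by rewrite -ler_rC rC0; apply: le_trans (Wc i).
    have bV j k : `|Vv ell N m u xi s j k| <= rC (n * (C3 * z `^ (- M - al / 4) * c)).
      by rewrite -Einv_Wv; apply: mulmx_entry_le Wc' j k; exact: b3.
    have v0 : 0 <= n * (C3 * z `^ (- M - al / 4) * c) by rewrite !mulr_ge0 ?powR_ge0.
    have bU j k : `|Uv ell u xi s j k| <= rC (2 * (n * (C3 * z `^ (- M - al / 4) * c))).
      apply: (near_identity_le (P := \sum_(1 <= k < m.+1) N k x)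
        (a := CP * z `^ (al - al / 2))) => //.
      - have zq : z `^ (al - al / 2) <= q0.
          have -> : al - al / 2 = be by rewrite /be; lra.
          have -> : q0 = (q0 `^ (2 / al)) `^ be.
            rewrite -powRrM /be mulrA divfK ?gt_eqF // mulfV // powRr1 //.
            exact: ltW.
          apply: (ge0_ler_powR (ltW be0)); rewrite ?nnegrE ?powR_ge0 //.
            exact: ltW.
          by case: (AZ0 s sb) => _ zr; exact: le_trans rho0q.
        have : n * CP * z `^ (al - al / 2) <= n * CP * q0.
          by rewrite ler_wpM2l // mulr_ge0.
        rewrite mulrA => /le_trans; apply.
        rewrite /q0 invfM mulrCA ler_piMr // ler_pdivrMr ?mul1r ?lerDl //.
        by rewrite ltr_wpDl // mulr_ge0.
      - by move=> j' k'; exact: bP.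
      - move=> j' k'; have := bV j' k'; congr (`|fun_of_matrix _ _ _| <= _).
        by rewrite /Vv /QP mulmxDl mul1mx.
    have i1 j k := mulmx_entry_le (b1 x Zs) Wc' j k.
    have i2 j k := mulmx_entry_le (b2 x Zs) bU j k.
    rewrite /dWv mxE normrM norm_rC (gtr0_norm dj0).
    rewrite -Einv_Wv [in X in X + _]mulmxA.
    apply: (@le_trans _ _ (rC (djap ell xi) *
        rC (n * (C1 * z `^ (al - 1 - al / 2) * c)
            + n * (C2 * z `^ (- M + (m%:R * al + aP ell) - al / 4) *
                   (2 * (n * (C3 * z `^ (- M - al / 4) * c))))))).
      apply: ler_wpM2l; first by rewrite -rC0 ler_rC ltW.
      rewrite rmorphD mxE; apply: le_trans (ler_normD _ _) _.
      by apply: lerD; [exact: i1|exact: i2].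
    rewrite -rmorphM ler_rC -/n -/z.
    have zz (e : R) : be - 1 <= e -> z `^ e <= z `^ (be - 1).
      by move=> h; apply: ger_powR => //; rewrite z0 ltW.
    set w := z `^ (be - 1).
    have w1 : z `^ (al - 1 - al / 2) <= w by apply: zz; rewrite /be; lra.
    (* Here 2 M <= m * al is used. *)
    have w2 : z `^ (- M + (m%:R * al + aP ell) - al / 4) * z `^ (- M - al / 4) <= w.
      rewrite -powRD; last by rewrite (gt_eqF z0) implybT.
      apply: zz; rewrite /be; move: mal; rewrite /al; lra.
    rewrite /g -/(zvar ell (s, xi)) -/z -/w.
    rewrite -[leRHS]mulrA [leRHS](_ : _ = djap ell xi * (K * w * c)); last by ring.
    apply: ler_wpM2l; first exact: ltW.
    have -> : K * w * c = n * C1 * c * w + 2 * n * n * C2 * C3 * c * w.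
      by rewrite /K; ring.
    apply: lerD.
      rewrite [leLHS](_ : _ = n * C1 * c * z `^ (al - 1 - al / 2)); last by ring.
      by apply: ler_wpM2l => //; rewrite !mulr_ge0.
    rewrite [leLHS](_ : _ = 2 * n * n * C2 * C3 * c *
       (z `^ (- M + (m%:R * al + aP ell) - al / 4) * z `^ (- M - al / 4))).
      2: by ring.
    by apply: ler_wpM2l => //; rewrite !mulr_ge0.
  have hWc s : 0 < s <= b -> forall i,
      deriv_within A (fun t => W t i 0) s (dWv ell D N Rm m u xi s i 0).
    by move=> sb i; exact: hW.
  exists b; split=> //.
  - move=> t /andP[t0 tT] tr; rewrite t0 le_min tT /=.
    by rewrite ler_pdivlMr // mulrC.
  - by rewrite WE; exact: (gronwall_cvg b0 hWc dW_le G_g g_ge0 G_bd).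
  - move=> s t sb tb; rewrite /UPz_ext /UPz0 /=.
    have := gronwall_energy_lim b0 hWc dW_le G_g g_ge0 G_bd sb tb.
    by rewrite -WE.
split=> [xi|xi t0 t1 t0T t1T t0r t1r]; first by have [b []] := main xi.
have [b [b0 hb _ he]] := main xi.
have := he t1 t0 (hb _ t1T t1r) (hb _ t0T t0r).
set X1 := UPz_ext _ _ _ _ (t1, xi); set X0 := UPz_ext _ _ _ _ (t0, xi) => hE.
have [a a0 aE] := mx_norm_rC X0.
have e0 : energy X0 <= n * a ^+ 2.
  by apply: energy_le => // i; rewrite -aE; exact: entry_le_norm.
have h : energy X1 <= expR (4 * n * MG) * n * a ^+ 2.
  by apply: le_trans hE _; rewrite -[leRHS]mulrA ler_wpM2l ?expR_ge0.
rewrite aE -rmorphM; apply/mx_norm_leP.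
  by rewrite -rC0 ler_rC mulr_ge0 ?sqrtr_ge0.
move=> i j; rewrite ord1; apply: le_trans (normC_sqrt_energy _ _) _.
rewrite ler_rC -[a in leRHS](ger0_norm a0) -sqrtr_sqr -sqrtrM ?ler_wsqrtr //.
by rewrite mulr_ge0 ?expR_ge0.
Qed.
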